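(* Let $E,F\to M$ be flat vector bundles of the same rank over a smooth manifold $M$, let $\xi\colon E\to TM$ be a bundle morphism such that $(\xi,\nabla)$ is torsion-free, let $\omega\in\Omega^2(M,F)$ satisfy $d^\nabla\omega=0$, and let $(P,\theta,\rho)$ be a shear total space for $\omega$, with projection $\pi\colon P\to M$. Then there exists a vector bundle morphism $\mathring\xi\colon\pi^*E\to TP$ which covers $\xi$, preserves $\theta$ (i.e. $\mathcal{L}^\nabla_{\mathring\xi}\theta=0$) and is such that $(\mathring\xi,\nabla)$ is torsion-free, if and only if $\mathcal{L}^\nabla_\xi\omega=0$, $\xi\lrcorner\,\omega$ is $d^\nabla$-exact and $\xi^*\omega=0$.
   Context: All flat connections, the induced connections on tensor products, duals and pull-backs are denoted $\nabla$; $d^\nabla$ is the covariant exterior derivative. Torsion-free: for a bundle map $\xi\colon E\to TM$ from a bundle with connection, $(\xi,\nabla)$ is torsion-free if $\xi(\nabla_{\xi e_1}e_2-\nabla_{\xi e_2}e_1)=[\xi e_1,\xi e_2]$ for all $e_1,e_2\in\Gamma(E)$. The same definition applies to $\mathring\xi\colon\pi^*E\to TP$, with $\pi^*E$ carrying the pulled-back connection. Contraction: for a $k$-form $\beta$ with values in a bundle $V$, $\xi\lrcorner\,\beta$ is the $(k-1)$-form with values in $E^*\otimes V$ given by $(\xi\lrcorner\,\beta)(X_2,\dots,X_k)(e)=\beta(\xi e,X_2,\dots,X_k)$, and $\mathcal{L}^\nabla_\xi\beta=d^\nabla(\xi\lrcorner\,\beta)+\xi\lrcorner\,d^\nabla\beta$;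 similarly for $\mathring\xi$ and forms on $P$ with values in pulled-back bundles. $\xi^*\omega(e_1,e_2)=\omega(\xi e_1,\xi e_2)$. ''$\xi\lrcorner\,\omega$ is $d^\nabla$-exact'' means that $\xi\lrcorner\,\omega=-d^\nabla a$ for some bundle map $a\colon E\to F$ (a section of $E^*\otimes F$). Shear total space: $P$ is a manifold with a foliation whose (connected) leaves have dimension $\operatorname{rk}E=\operatorname{rk}F$, $M$ is the leaf space and $\pi\colon P\to M$ the projection, a surjective submersion; $\rho\colon\pi^*F\to TP$ is a vector bundle morphism and $\theta\in\Omega^1(P,\pi^*F)$, with (1) $\theta\circ\rho=\mathrm{id}_{\pi^*F}$, (2) $d\pi\circ\rho=0$, (3) $d^\nabla\theta=\pi^*\omega$. $\mathring\xi$ covers $\xi$ means that $d\pi_p(\mathring\xi(p,e))=\xi(e)$ for all $p\in P$, $e\in E_{\pi(p)}$. *)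

(* Defs.v *)
From HB Require Import structures.
From mathcomp Require Import all_boot all_order all_algebra all_classical all_reals.
From mathcomp Require Import topology normedtype landau derive.
Set Implicit Arguments.
Unset Strict Implicit.
Unset Printing Implicit Defensive.
Import Order.TTheory GRing.Theory Num.Theory numFieldNormedType.Exports.
Local Open Scope classical_set_scope.
Local Open Scope ring_scope.

Section Calculus.
Context {R : realType}.

Lemma near_eq_differentiable (V W : normedModType R) (f g : V -> W) (x : V) :
  {near x, f =1 g} -> differentiable f x -> differentiable g x.
Proof.
move=> fg df; have fgx : f x = g x := nbhs_singleton fg.
have dg : g \o shift x = cst (g x) + 'd f x +o_ 0 id.
  apply/eqaddoP => e e0.
  have := diff_locally df; move/eqaddoP => /(_ e e0) H.
  have fg0 : \forall y \near 0, f (y + x) = g (y + x).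
    by move: fg => /nbhs0P; apply: filterS => y /=; rewrite [x + y]addrC.
  apply: filterS2 fg0 H => y fgy.
  rewrite -[(f \o shift x - _) y]/(f (y + x) - (f x + 'd f x y)).
  by rewrite -[(g \o shift x - _) y]/(g (y + x) - (g x + 'd f x y)) -fgy -fgx.
have dE : 'd g x = 'd f x :> (V -> W).
  by apply: diff_unique dg; exact: diff_continuous.
by apply/diff_locallyP; rewrite dE; split=> //; exact: diff_continuous.
Qed.

Lemma derive_chain (U V W : normedModType R) (f : U -> V) (g : V -> W) x v :
  differentiable f x -> differentiable g (f x) ->
  'D_v (g \o f) x = 'D_('D_v f x) g (f x).
Proof.
move=> df dg; rewrite !deriveE//; last exact: differentiable_comp.
by rewrite diff_comp.
Qed.

Lemma derive_lin (V W : normedModType R) (L : {linear V -> W}) x v :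
  continuous L -> 'D_v L x = L v.
Proof. by move=> cL; rewrite deriveE ?diff_lin//; exact: linear_differentiable. Qed.

Lemma scale_is_bilinear (V : normedModType R) :
  bilinear_for (GRing.Scale.Law.clone _ _ *:%R _) (GRing.Scale.Law.clone _ _ *:%R _)
    (@GRing.scale R V : R^o -> V -> V).
Proof.
split=> [u a x y|u a x y] /=; first by rewrite scalerDl scalerA.
by rewrite scalerDr !scalerA mulrC.
Qed.

Lemma derive_scale (U V : normedModType R) (a : U -> R) (f : U -> V) x :
  differentiable a x -> differentiable f x ->
  differentiable (fun y => a y *: f y) x /\
  forall v, 'D_v (fun y => a y *: f y) x = a x *: 'D_v f x + 'D_v a x *: f x.
Proof.
move=> da df.
pose mB := bilinear_isBilinear.Build R R^o V V _ _
  (@GRing.scale R V : R^o -> V -> V) (@scale_is_bilinear V).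
pose B : {bilinear R^o -> V -> V} :=
  HB.pack (@GRing.scale R V : R^o -> V -> V) mB.
have cB : continuous (fun p : R^o * V => B p.1 p.2) by exact: scale_continuous.
have dp : differentiable (fun y => (a y : R^o, f y)) x by exact: differentiable_pair.
have dB := @differentiable_bilin _ _ _ _ B (a x : R^o, f x) cB.
have dd := differentiable_comp dp dB.
split=> // v; rewrite !deriveE//.
apply: etrans (congr1 (@^~ v) (diff_comp dp dB)) _.
have /(congr1 (@^~ v)) /= Ep := diff_pair (da : differentiable (a : U -> R^o) x) df.
rewrite /= Ep.
exact: (congr1 (@^~ ('d a x v : R^o, 'd f x v))
  (@diff_bilin _ _ _ _ B (a x : R^o, f x) cB)).
Qed.

Lemma derive_sum_coord (m : nat) (V : normedModType R) (g : 'rV[R]_m -> V) x w :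
  differentiable g x -> 'D_w g x = \sum_j w 0 j *: 'D_(delta_mx 0 j) g x.
Proof.
move=> dg; rewrite deriveE// {1}[w]row_sum_delta linear_sum.
by apply: eq_bigr => j _; rewrite linearZ deriveE.
Qed.

Fixpoint Ck (n : nat) (V : normedModType R) (k : nat) (U : set 'rV[R]_n)
    (f : 'rV[R]_n -> V) : Prop :=
  if k is k'.+1 then
    (forall x, U x -> differentiable f x) /\ (forall v, Ck k' U ('D_v f))
  else forall x, U x -> {for x, continuous f}.

(* C^oo on the open set U; the values of f outside U are irrelevant. *)
Definition smooth_on (n : nat) (V : normedModType R) (U : set 'rV[R]_n)
    (f : 'rV[R]_n -> V) : Prop := forall k, Ck k U f.

Lemma Ck_eq n (V : normedModType R) k (U : set 'rV[R]_n) (f g : 'rV[R]_n -> V) :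
  open U -> {in U, f =1 g} -> Ck k U f -> Ck k U g.
Proof.
move=> oU; elim: k f g => [|k IH] f g fg /=.
  move=> cf x Ux; have nfg : {near x, f =1 g}.
    by apply: filterS (open_nbhs_nbhs (conj oU Ux)) => y Uy; apply: fg; rewrite inE.
  rewrite /prop_for /continuous_at -(nbhs_singleton nfg).
  exact: cvg_trans (@near_eq_cvg _ _ (nbhs x) _ _ _ nfg) (cf x Ux).
move=> [df Cf]; have nfg x : U x -> {near x, f =1 g}.
  by move=> Ux; apply: filterS (open_nbhs_nbhs (conj oU Ux)) => y Uy; apply: fg; rewrite inE.
split=> [x Ux|v]; first exact: near_eq_differentiable (nfg x Ux) (df x Ux).
apply: IH (Cf v) => x; rewrite inE => Ux.
exact: near_eq_derive (nfg x Ux).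
Qed.

Lemma Ck_local n (V : normedModType R) k (U : set 'rV[R]_n) (f : 'rV[R]_n -> V) :
  (forall x, U x -> exists2 W, W x & Ck k W f) -> Ck k U f.
Proof.
elim: k f => [|k IH] f /= H.
  by move=> x /H[W Wx]; apply.
split=> [x /H[W Wx []]|v]; first by move=> + _; apply.
by apply: IH => x /H[W Wx [_ CW]]; exists W.
Qed.

Lemma Ck_sub n (V : normedModType R) k (U W : set 'rV[R]_n) (f : 'rV[R]_n -> V) :
  U `<=` W -> Ck k W f -> Ck k U f.
Proof. by move=> UW CW; apply: Ck_local => x Ux; exists W => //; exact: UW. Qed.

Lemma CkS n (V : normedModType R) k (U : set 'rV[R]_n) (f : 'rV[R]_n -> V) :
  Ck k.+1 U f -> Ck k U f.
Proof.
elim: k f => [|k IH] f.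
  by move=> [df _] x Ux; exact: differentiable_continuous (df x Ux).
by move=> [df Cf]; split=> // v; exact: IH (Cf v).
Qed.

Lemma Ck_cst n (V : normedModType R) k (U : set 'rV[R]_n) (a : V) :
  Ck k U (cst a).
Proof.
elim: k a => [|k IH] a; first by move=> x _; exact: cst_continuous.
split=> [x _|v]; first exact: differentiable_cst.
rewrite (_ : 'D_v (cst a) = cst 0); first exact: IH.
by apply/funext => x; rewrite derive_cst.
Qed.

Lemma CkD n (V : normedModType R) k (U : set 'rV[R]_n) (f g : 'rV[R]_n -> V) :
  open U -> Ck k U f -> Ck k U g -> Ck k U (f + g).
Proof.
move=> oU; elim: k f g => [|k IH] f g.
  by move=> cf cg x Ux; apply: continuousD; [exact: cf|exact: cg].
move=> [df Cf] [dg Cg]; split=> [x Ux|v].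
  by apply: differentiableD; [exact: df|exact: dg].
apply: Ck_eq (IH _ _ (Cf v) (Cg v)) => // x; rewrite inE => Ux.
by rewrite deriveD//; apply: diff_derivable; [exact: df|exact: dg].
Qed.

Lemma Ck_sum n (V : normedModType R) k (U : set 'rV[R]_n) (I : Type)
    (s : seq I) (f : I -> 'rV[R]_n -> V) :
  open U -> (forall i, Ck k U (f i)) -> Ck k U (fun x => \sum_(i <- s) f i x).
Proof.
move=> oU Cf; elim: s => [|i s IH].
  by apply: Ck_eq (Ck_cst k U 0) => // x _; rewrite big_nil.
by apply: Ck_eq (CkD oU (Cf i) IH) => // x _; rewrite big_cons.
Qed.

Lemma Ck_lin n (V W : normedModType R) k (U : set 'rV[R]_n) (L : {linear V -> W})
    (f : 'rV[R]_n -> V) :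
  open U -> continuous L -> Ck k U f -> Ck k U (L \o f).
Proof.
move=> oU cL; elim: k f => [|k IH] f.
  by move=> cf x Ux; apply: continuous_comp; [exact: cf|exact: cL].
have dL x : differentiable L x by exact: linear_differentiable.
move=> [df Cf]; split=> [x Ux|v]; first exact: differentiable_comp (df x Ux) (dL _).
apply: Ck_eq (IH _ (Cf v)) => // x; rewrite inE => Ux.
by rewrite (derive_chain v (df x Ux) (dL (f x))) derive_lin.
Qed.

Lemma CkZ n (V : normedModType R) k (U : set 'rV[R]_n) (a : 'rV[R]_n -> R)
    (f : 'rV[R]_n -> V) :
  open U -> Ck k U a -> Ck k U f -> Ck k U (fun x => a x *: f x).
Proof.
move=> oU; elim: k a f => [|k IH] a f.
  by move=> ca cf x Ux; apply: continuousZ; [exact: ca|exact: cf].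
move=> Ca Cf; move: (Ca) (Cf) => [da Ca'] [df Cf'].
split=> [x Ux|v]; first by have [] := derive_scale (da x Ux) (df x Ux).
have Ca0 := CkS Ca; have Cf0 := CkS Cf.
apply: Ck_eq (CkD oU (IH _ _ Ca0 (Cf' v)) (IH _ _ (Ca' v) Cf0)) => // x.
by rewrite inE => Ux; have [_ ->] := derive_scale (da x Ux) (df x Ux).
Qed.

Lemma Ck_coord n m k (U : set 'rV[R]_n) (f : 'rV[R]_n -> 'rV[R]_m) j :
  open U -> Ck k U f -> Ck k U (fun x => f x 0 j : R^o).
Proof.
move=> oU Cf.
have lin : linear (fun N : 'rV[R]_m => N 0 j : R^o) by move=> a u v; rewrite !mxE.
pose lM := GRing.isLinear.Build _ _ _ _ _ lin.
pose L : {linear 'rV[R]_m -> R^o} := HB.pack (fun N : 'rV[R]_m => N 0 j : R^o) lM.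
by apply: (@Ck_lin _ _ _ k U L) => //; exact: coord_continuous.
Qed.

Lemma Ck_comp n m (V : normedModType R) k (U : set 'rV[R]_n) (W : set 'rV[R]_m)
    (f : 'rV[R]_n -> 'rV[R]_m) (g : 'rV[R]_m -> V) :
  open U -> (forall x, U x -> W (f x)) ->
  Ck k U f -> Ck k W g -> Ck k U (g \o f).
Proof.
move=> oU fUW; elim: k g => [|k IH] g.
  move=> cf cg x Ux; apply: continuous_comp; first exact: cf.
  exact/cg/fUW.
move=> Cf Cg; move: (Cf) (Cg) => [df Cf'] [dg Cg'].
split=> [x Ux|v].
  exact: differentiable_comp (df x Ux) (dg _ (fUW x Ux)).
have C : Ck k U (fun x => \sum_j ('D_v f x) 0 j *: 'D_(delta_mx 0 j) g (f x)).
  apply: Ck_sum => // j; apply: CkZ => //; first exact: (Ck_coord j oU (Cf' v)).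
  by apply: IH (Cg' _); exact: CkS.
apply: Ck_eq C => // x; rewrite inE => Ux.
rewrite (derive_chain v (df x Ux) (dg _ (fUW x Ux))).
by rewrite (derive_sum_coord _ (dg _ (fUW x Ux))).
Qed.

End Calculus.

Section Geometry.
Variable R : realType.

Record chart (n : nat) (T : topologicalType) := Chart {
  cdom : set T;
  cmap : T -> 'rV[R]_n;
  cinv : 'rV[R]_n -> T;
  cdom_open : open cdom;
  cimg_open : open (cmap @` cdom);
  cmapK : forall p, cdom p -> cinv (cmap p) = p;
  cmap_continuous : forall p, cdom p -> {for p, continuous cmap};
  cinv_continuous : forall p, cdom p -> {for cmap p, continuous cinv} }.

Lemma chart_img_open n (T : topologicalType) (c : chart n T) (W : set T) :
  open W -> open (cmap c @` (W `&` cdom c)).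
Proof.
move=> oW; rewrite openE => _ [p [Wp cp] <-].
have nW : nbhs (cmap c p) (cinv c @^-1` W).
  by apply: (cinv_continuous cp); rewrite cmapK//; exact: open_nbhs_nbhs.
have nD : nbhs (cmap c p) (cmap c @` cdom c).
  by apply: open_nbhs_nbhs; split; [exact: cimg_open|exists p].
apply: filterS2 nW nD => x Wx [q cq qx]; move: Wx.
by rewrite -qx /= cmapK// => Wq; exists q.
Qed.

Definition compatible n (T : topologicalType) (c d : chart n T) : Prop :=
  smooth_on (cmap c @` (cdom c `&` cdom d)) (cmap d \o cinv c).

(* An atlas need not be maximal.  [chart_at] is a preferred chart around each
   point, used below to give the tangent spaces a concrete model. *)
Record manifold (n : nat) := Manifold {
  mcarrier :> topologicalType;
  m_hausdorff : hausdorff_space mcarrier;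
  m_second_countable : @second_countable mcarrier;
  atlas : set (chart n mcarrier);
  chart_at : mcarrier -> chart n mcarrier;
  atlas_at : forall p, atlas (chart_at p);
  cdom_at : forall p, cdom (chart_at p) p;
  atlas_compatible : forall c d, atlas c -> atlas d -> compatible c d }.

(* Smoothness on the open set W of a function with values in a normed space. *)
Definition msmooth n (M : manifold n) (V : normedModType R) (W : set M)
    (f : M -> V) : Prop :=
  forall c, atlas c -> smooth_on (cmap c @` (W `&` cdom c)) (f \o cinv c).

Definition smooth_map m n (N : manifold m) (M : manifold n) (f : N -> M) : Prop :=
  continuous f /\
  forall (c : chart m N) (d : chart n M), atlas c -> atlas d ->
    smooth_on (cmap c @` (cdom c `&` f @^-1` cdom d)) (cmap d \o f \o cinv c).

(* A vector bundle of rank r over M: a family of vector spaces with local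
   trivialisations (fibrewise linear isomorphisms with R^r over tdom i) whose
   transition functions are smooth. *)
Record vbundle n (M : manifold n) (r : nat) := VBundle {
  fiber :> M -> lmodType R;
  tidx : Type;
  tdom : tidx -> set M;
  triv : tidx -> forall p, {linear fiber p -> 'rV[R]_r};
  trivV : tidx -> forall p, {linear 'rV[R]_r -> fiber p};
  triv_at : M -> tidx;
  tdom_open : forall i, open (tdom i);
  tdom_at : forall p, tdom (triv_at p) p;
  trivK : forall i p, tdom i p -> cancel (triv i p) (trivV i p);
  trivVK : forall i p, tdom i p -> cancel (trivV i p) (triv i p);
  triv_smooth : forall i j (u : 'rV[R]_r),
    msmooth (tdom i `&` tdom j) (fun p => triv j p (trivV i p u)) }.

Section Tangent.
Variables (n : nat) (M : manifold n).

Definition chart_diff (c d : chart n M) (p : M) : {linear 'rV[R]_n -> 'rV[R]_n} :=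
  mulmxr ('J (cmap d \o cinv c) (cmap c p)).

Lemma compatible_differentiable (c d : chart n M) p :
  atlas c -> atlas d -> cdom c p -> cdom d p ->
  differentiable (cmap d \o cinv c) (cmap c p).
Proof.
move=> ac ad cp dp; have [+ _] := atlas_compatible ac ad 1%N.
by apply; exists p.
Qed.

Lemma chart_diffE (c d : chart n M) p v :
  atlas c -> atlas d -> cdom c p -> cdom d p ->
  chart_diff c d p v = 'D_v (cmap d \o cinv c) (cmap c p).
Proof.
by move=> ac ad cp dp; rewrite deriveEjacobian//; exact: compatible_differentiable.
Qed.

Lemma chart_diff_comp (c d e : chart n M) p v :
  atlas c -> atlas d -> atlas e -> cdom c p -> cdom d p -> cdom e p ->
  chart_diff d e p (chart_diff c d p v) = chart_diff c e p v.
Proof.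
move=> ac ad ae cp dp ep.
apply: etrans (congr1 (chart_diff d e p) (chart_diffE v ac ad cp dp)) _.
apply: etrans (chart_diffE _ ad ae dp ep) _.
apply: etrans _ (esym (chart_diffE v ac ae cp ep)).
have dcd := compatible_differentiable ac ad cp dp.
have pE : (cmap d \o cinv c) (cmap c p) = cmap d p by rewrite /= cmapK.
have dde : differentiable (cmap e \o cinv d) ((cmap d \o cinv c) (cmap c p)).
  by rewrite pE; exact: compatible_differentiable.
rewrite -{1}pE -(derive_chain v dcd dde); apply: near_eq_derive.
have : nbhs (cmap c p) (cmap c @` (cdom d `&` cdom c)).
  apply: open_nbhs_nbhs; split; first exact/chart_img_open/cdom_open.
  by exists p.
by apply: filterS => _ [q [dq cq] <-] /=; rewrite cmapK// cmapK.
Qed.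

Lemma chart_diff_id (c : chart n M) p v :
  atlas c -> cdom c p -> chart_diff c c p v = v.
Proof.
move=> ac cp; rewrite chart_diffE// -[RHS](@derive_id _ _ (cmap c p)).
apply: near_eq_derive.
have : nbhs (cmap c p) (cmap c @` cdom c).
  by apply: open_nbhs_nbhs; split; [exact: cimg_open|exists p].
by apply: filterS => _ [q cq <-] /=; rewrite cmapK.
Qed.

Let tidx := {c : chart n M | atlas c}.

Lemma tangent_smooth (i j : tidx) (u : 'rV[R]_n) :
  msmooth (cdom (sval i) `&` cdom (sval j))
    (fun p => chart_diff (chart_at p) (sval j) p
                (chart_diff (sval i) (chart_at p) p u)).
Proof.
move: i j => [c ac] [d ad] e ae k /=.
set W := (X in Ck k X _).
have oW : open W.
  by apply: chart_img_open; apply: openI; exact: cdom_open.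
have [_ Cd] := atlas_compatible ac ad k.+1.
have Ce : Ck k W (cmap c \o cinv e).
  apply: Ck_sub (atlas_compatible ae ac k) => _ [q [[cq dq] eq] <-].
  by exists q.
have sW x : W x -> (cmap c @` (cdom c `&` cdom d)) ((cmap c \o cinv e) x).
  by move=> [q [[cq dq] eq] <-]; exists q => //=; rewrite cmapK.
apply: Ck_eq (Ck_comp oW sW Ce (Cd u)) => // x.
rewrite inE => -[q [[cq dq] eq] <-].
rewrite /comp (cmapK eq) -(chart_diffE u ac ad cq dq); apply: esym.
exact: chart_diff_comp u ac (atlas_at q) ad cq (cdom_at q) dq.
Qed.

Lemma tangentK (i : tidx) p : cdom (sval i) p ->
  cancel (chart_diff (chart_at p) (sval i) p) (chart_diff (sval i) (chart_at p) p).
Proof.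
move: i => [c ac] cp v.
exact: etrans (chart_diff_comp v (atlas_at p) ac (atlas_at p) (cdom_at p) cp (cdom_at p))
  (chart_diff_id v (atlas_at p) (cdom_at p)).
Qed.

Lemma tangentVK (i : tidx) p : cdom (sval i) p ->
  cancel (chart_diff (sval i) (chart_at p) p) (chart_diff (chart_at p) (sval i) p).
Proof.
move: i => [c ac] cp v.
exact: etrans (chart_diff_comp v ac (atlas_at p) ac cp (cdom_at p) cp)
  (chart_diff_id v ac cp).
Qed.

(* T_p M is R^n, a tangent vector being represented by its coordinates in
   [chart_at p]; its coordinates in another chart are given by the Jacobian. *)
Definition TM : vbundle M n := {|
  fiber := fun=> 'rV[R]_n : lmodType R;
  tdom := fun i : tidx => cdom (sval i);
  triv := fun i p => chart_diff (chart_at p) (sval i) p;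
  trivV := fun i p => chart_diff (sval i) (chart_at p) p;
  triv_at := fun p => exist _ (chart_at p) (atlas_at p);
  tdom_open := fun i => cdom_open (sval i);
  tdom_at := @cdom_at n M;
  trivK := tangentK;
  trivVK := tangentVK;
  triv_smooth := tangent_smooth |}.

End Tangent.

Section Pullback.
Variables (m n r : nat) (N : manifold m) (M : manifold n) (E : vbundle M r).
Variables (f : N -> M) (sf : smooth_map f).

Lemma pullback_open i : open (f @^-1` @tdom n M r E i).
Proof. by move: sf => [cf _]; apply: open_comp (tdom_open i) => x _; exact: cf. Qed.

Lemma pullback_smooth (i j : tidx E) (u : 'rV[R]_r) :
  msmooth (f @^-1` tdom i `&` f @^-1` tdom j)
    (fun p => triv j (f p) (trivV i (f p) u)).
Proof.
move=> c ac k; move: (sf) => [cf Cf].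
apply: Ck_local => _ [p [[ip jp] cp] <-].
pose d := chart_at (f p); have ad : atlas d by exact: atlas_at.
pose W := cmap c @` ((f @^-1` tdom i `&` f @^-1` tdom j `&` f @^-1` cdom d) `&` cdom c).
have oW : open W.
  apply: chart_img_open; apply: openI; first by apply: openI; exact: pullback_open.
  by apply: open_comp (cdom_open d) => x _; exact: cf.
exists W; first by exists p => //; do !split => //; exact: cdom_at.
have C1 : Ck k W (cmap d \o f \o cinv c).
  by apply: Ck_sub (Cf c d ac ad k) => _ [q [[_ dq] cq] <-]; exists q.
have sW x : W x ->
    (cmap d @` (tdom i `&` tdom j `&` cdom d)) ((cmap d \o f \o cinv c) x).
  by move=> [q [[[iq jq] dq] cq] <-]; exists (f q) => //=; rewrite cmapK.
apply: Ck_eq (Ck_comp oW sW C1 (triv_smooth i j u ad k)) => // x.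
by rewrite inE => -[q [[[iq jq] dq] cq] <-]; rewrite /comp (cmapK cq) (cmapK dq).
Qed.

Definition pullback : vbundle N r := {|
  fiber := fun p => E (f p);
  tdom := fun i : tidx E => f @^-1` tdom i;
  triv := fun i p => triv i (f p);
  trivV := fun i p => trivV i (f p);
  triv_at := fun p => triv_at E (f p);
  tdom_open := pullback_open;
  tdom_at := fun p => tdom_at E (f p);
  trivK := fun i p => @trivK n M r E i (f p);
  trivVK := fun i p => @trivVK n M r E i (f p);
  triv_smooth := pullback_smooth |}.

End Pullback.

Definition section n (M : manifold n) r (E : vbundle M r) := forall p, E p.

Definition smooth_section_on n (M : manifold n) r (E : vbundle M r) (W : set M)
    (s : section E) : Prop :=
  forall i : tidx E, msmooth (W `&` tdom i) (fun p => triv i p (s p)).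

Definition smooth_section n (M : manifold n) r (E : vbundle M r) (s : section E) :
  Prop := smooth_section_on setT s.

Definition smooth_near n (M : manifold n) r (E : vbundle M r) (p : M)
    (s : section E) : Prop :=
  exists W : set M, [/\ open W, W p & smooth_section_on W s].

(* Vector bundle morphisms over the identity.  Smoothness: the frame vectors of
   every local trivialisation are mapped to smooth local sections. *)
Record bmap n (M : manifold n) r1 r2 (E : vbundle M r1) (F : vbundle M r2) := BMap {
  bmap_fun :> forall p, {linear E p -> F p};
  bmap_smooth : forall (i : tidx E) (u : 'rV[R]_r1),
    smooth_section_on (tdom i) (fun p => bmap_fun p (trivV i p u) : F p) }.

Definition oneform n (M : manifold n) r (V : vbundle M r) := bmap (TM M) V.

Record twoform n (M : manifold n) r (V : vbundle M r) := TwoForm {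
  twoform_fun :> forall p, TM M p -> TM M p -> V p;
  twoform_linear : forall p u, linear (@twoform_fun p u);
  twoform_linearl : forall p v, linear ((@twoform_fun p)^~ v);
  twoform_alternate : forall p u, @twoform_fun p u u = 0;
  twoform_smooth : forall (i j : tidx (TM M)) (u v : 'rV[R]_n),
    smooth_section_on (tdom i `&` tdom j)
      (fun p => @twoform_fun p (trivV i p u) (trivV j p v)) }.

Definition dirder n (M : manifold n) (p : M) (v : TM M p) (g : M -> R) : R :=
  'D_(v : 'rV[R]_n) (g \o cinv (chart_at p)) (cmap (chart_at p) p).

Definition mdiff m n (N : manifold m) (M : manifold n) (f : N -> M) (p : N)
    (v : TM N p) : TM M (f p) :=
  'D_(v : 'rV[R]_m) (cmap (chart_at (f p)) \o f \o cinv (chart_at p))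
    (cmap (chart_at p) p).

Definition vf_coord n (M : manifold n) (c : chart n M) (X : section (TM M))
    (x : 'rV[R]_n) : 'rV[R]_n :=
  chart_diff (chart_at (cinv c x)) c (cinv c x) (X (cinv c x)).

(* [X, Y]^k = X (Y^k) - Y (X^k), computed in the preferred chart. *)
Definition lie_bracket n (M : manifold n) (X Y : section (TM M)) : section (TM M) :=
  fun p => let c := chart_at p in
    'D_(X p : 'rV[R]_n) (vf_coord c Y) (cmap c p) -
    'D_(Y p : 'rV[R]_n) (vf_coord c X) (cmap c p).

(* A covariant derivative acts on tangent vectors at p and on sections defined
   near p; since sections here are total functions, it is only constrained on
   those that are smooth near p. *)
Definition covder n (M : manifold n) r (E : vbundle M r) :=
  forall p, TM M p -> section E -> E p.

Record is_connection n (M : manifold n) r (E : vbundle M r) (D : covder E) : Prop :=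
  IsConnection {
    conn_linear : forall p s, smooth_near p s -> linear (fun v => D p v s);
    conn_add : forall p v s t, smooth_near p s -> smooth_near p t ->
      D p v (fun q => s q + t q) = D p v s + D p v t;
    conn_leibniz : forall p v (g : M -> R) s,
      (exists W : set M, [/\ open W, W p & msmooth W (g : M -> R^o)]) ->
      smooth_near p s ->
      D p v (fun q => g q *: s q) = dirder v g *: s p + g p *: D p v s;
    conn_smooth : forall (W : set M) (X : section (TM M)) (s : section E),
      open W -> smooth_section_on W X -> smooth_section_on W s ->
      smooth_section_on W (fun p => D p (X p) s) }.

Definition is_flat n (M : manifold n) r (E : vbundle M r) (D : covder E) : Prop :=
  forall (X Y : section (TM M)) (s : section E),
    smooth_section X -> smooth_section Y -> smooth_section s ->
    forall p, D p (X p) (fun q => D q (Y q) s) - D p (Y p) (fun q => D q (X q) s)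
              - D p (lie_bracket X Y p) s = 0.

(* The connection induced on the pull-back bundle: if e_k is the local frame
   given by a trivialisation of E around f p and s = \sum_k s_k (e_k \o f), then
   D_v s = \sum_k (v s_k) e_k (f p) + s_k p * D_(df v) e_k. *)
Definition pullback_covder m n (N : manifold m) (M : manifold n) r
    (E : vbundle M r) (f : N -> M) (sf : smooth_map f) (D : covder E) :
    covder (pullback E sf) :=
  fun p v s =>
    let i := triv_at E (f p) in
    let e k : section E := fun y => trivV i y (delta_mx 0 k) in
    let a k (q : N) : R := triv i (f q) (s q) 0 k in
    \sum_(k < r) (dirder v (a k) *: e k (f p) +
                  a k p *: D (f p) (mdiff f v) (e k)).

Arguments pullback_covder {m n N M r E f} sf D.

(* The connection induced on Hom(E, V) = E^* (x) V, evaluated on a section e: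
   (D_v A) e = D_v (A e) - A (D_v e). *)
Definition hom_covder n (M : manifold n) r s (E : vbundle M r) (V : vbundle M s)
    (DE : covder E) (DV : covder V) (A : forall q, E q -> V q)
    (p : M) (v : TM M p) (e : section E) : V p :=
  DV p v (fun q => A q (e q)) - A p (DE p v e).

(* Exterior derivatives, as functions of vector fields. *)
Definition ext_d1 n (M : manifold n) r (V : vbundle M r) (DV : covder V)
    (b : oneform V) (X Y : section (TM M)) : section V :=
  fun p => DV p (X p) (fun q => b q (Y q)) - DV p (Y p) (fun q => b q (X q))
           - b p (lie_bracket X Y p).

Definition ext_d2 n (M : manifold n) r (V : vbundle M r) (DV : covder V)
    (b : twoform V) (X Y Z : section (TM M)) : section V :=
  fun p => DV p (X p) (fun q => b q (Y q) (Z q))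
           - DV p (Y p) (fun q => b q (X q) (Z q))
           + DV p (Z p) (fun q => b q (X q) (Y q))
           - b p (lie_bracket X Y p) (Z p) + b p (lie_bracket X Z p) (Y p)
           - b p (lie_bracket Y Z p) (X p).

(* The same for a 1-form b with values in Hom(E, V), evaluated on a section e. *)
Definition ext_d1_hom n (M : manifold n) r s (E : vbundle M r) (V : vbundle M s)
    (DE : covder E) (DV : covder V) (b : forall q, TM M q -> E q -> V q)
    (X Y : section (TM M)) (e : section E) : section V :=
  fun p => hom_covder DE DV (fun q => b q (Y q)) (X p) e
           - hom_covder DE DV (fun q => b q (X q)) (Y p) e
           - b p (lie_bracket X Y p) (e p).

Definition contract1 n (M : manifold n) r s (E : vbundle M r) (V : vbundle M s)
    (xi : bmap E (TM M)) (b : oneform V) : forall q, E q -> V q :=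
  fun q e => b q (xi q e).

Definition contract2 n (M : manifold n) r s (E : vbundle M r) (V : vbundle M s)
    (xi : bmap E (TM M)) (b : twoform V) :
    forall q, TM M q -> E q -> V q :=
  fun q x e => b q (xi q e) x.

(* L_xi b = d (xi _| b) + xi _| d b for 1-forms and 2-forms b: a form with values
   in Hom(E, V), evaluated on vector fields and on a section e of E. *)
Definition lie_derivative1 n (M : manifold n) r s (E : vbundle M r) (V : vbundle M s)
    (DE : covder E) (DV : covder V) (xi : bmap E (TM M))
    (b : oneform V) (X : section (TM M)) (e : section E) : section V :=
  fun p => hom_covder DE DV (contract1 xi b) (X p) e
           + ext_d1 DV b (fun q => xi q (e q)) X p.

Definition lie_derivative2 n (M : manifold n) r s (E : vbundle M r) (V : vbundle M s)
    (DE : covder E) (DV : covder V) (xi : bmap E (TM M))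
    (b : twoform V) (X Y : section (TM M)) (e : section E) :
    section V :=
  fun p => ext_d1_hom DE DV (contract2 xi b) X Y e p
           + ext_d2 DV b (fun q => xi q (e q)) X Y p.

Definition torsion_free n (M : manifold n) r (E : vbundle M r) (D : covder E)
    (xi : bmap E (TM M)) : Prop :=
  forall e1 e2 : section E, smooth_section e1 -> smooth_section e2 ->
  forall p, xi p (D p (xi p (e1 p)) e2 - D p (xi p (e2 p)) e1) =
            lie_bracket (fun q => xi q (e1 q)) (fun q => xi q (e2 q)) p.

(* A foliation of P with leaves of dimension r and codimension q, given by an
   atlas of foliated charts: the image of each chart is a cube (a ball for the
   sup norm) of R^q x R^r, the plaques are the slices on which the first q
   coordinates are constant, and the changes of charts locally map plaques to
   plaques. *)
Record foliation (q r : nat) (P : manifold (q + r)) := Foliation {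
  fol_atlas : set (chart (q + r) P);
  fol_cover : forall p, exists2 c, fol_atlas c & cdom c p;
  fol_compatible : forall c d, fol_atlas c -> atlas d ->
    compatible c d /\ compatible d c;
  fol_cube : forall c, fol_atlas c ->
    exists x (e : R), 0 < e /\ cmap c @` cdom c = ball x e;
  fol_transition : forall c d, fol_atlas c -> fol_atlas d ->
    forall p, cdom c p -> cdom d p ->
    exists2 W : set P, open_nbhs p W & forall a b, W a -> W b ->
      lsubmx (cmap c a) = lsubmx (cmap c b) ->
      lsubmx (cmap d a) = lsubmx (cmap d b) }.

(* The leaves are the classes of points joined by a finite chain of plaques. *)
Inductive same_leaf q r (P : manifold (q + r)) (L : foliation P) (a : P) : P -> Prop :=
| same_leaf_refl : same_leaf L a a
| same_leaf_step c b b' : same_leaf L a b -> fol_atlas L c -> cdom c b -> cdom c b' ->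
    lsubmx (cmap c b) = lsubmx (cmap c b') -> same_leaf L a b'.

(* As M is the leaf space, dim P = dim M + r and the leaves are the fibres of
   the projection. *)
Record shear_total_space n (M : manifold n) r (F : vbundle M r) (D : covder F)
    (omega : twoform F) := ShearTotalSpace {
  sts_space :> manifold (n + r);
  sts_foliation : foliation sts_space;
  sts_proj : sts_space -> M;
  sts_smooth : smooth_map sts_proj;
  sts_surjective : forall x, exists p, sts_proj p = x;
  sts_submersion : forall p (w : TM M (sts_proj p)),
    exists v : TM sts_space p, mdiff sts_proj v = w;
  sts_leaves : forall p q,
    same_leaf sts_foliation p q <-> sts_proj p = sts_proj q;
  sts_rho : bmap (pullback F sts_smooth) (TM sts_space);
  sts_theta : oneform (pullback F sts_smooth);
  sts_theta_rho : forall p f, sts_theta p (sts_rho p f) = f;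
  sts_proj_rho : forall p f, mdiff sts_proj (sts_rho p f) = 0;
  sts_d_theta : forall X Y : section (TM sts_space),
    smooth_section X -> smooth_section Y -> forall p,
    ext_d1 (pullback_covder sts_smooth D) sts_theta X Y p =
    omega (sts_proj p) (mdiff sts_proj (X p)) (mdiff sts_proj (Y p)) }.

End Geometry.

Arguments pullback_covder {R m n N M r E f} sf D.
Arguments sts_proj {R n M r F D omega} s _.

(* Main.v *)
From HB Require Import structures.
Require Import Defs.
From mathcomp Require Import all_boot all_order all_algebra all_classical all_reals.
From mathcomp Require Import topology normedtype landau derive sequences exp.
From mathcomp Require Import interval_inference ring lra.
Set Implicit Arguments.
Unset Strict Implicit.
Unset Printing Implicit Defensive.
Import Order.TTheory GRing.Theory Num.Theory numFieldNormedType.Exports.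
Local Open Scope classical_set_scope.
Local Open Scope ring_scope.

(** Write [pi] for the projection of [P] and [d] for covariant exterior derivatives.

    Given a lift [xi'] of [xi], let [A = xi' _| theta], a section over [P] of the pull-back
    of Hom(E, F). As [d theta] is the pull-back of [omega], the lift preserves [theta] if
    and only if [(d A) (X) e = - omega (xi e, d pi X)] for all [X] and [e]
    ([pairing_derivative]). For vertical [X] the right-hand side vanishes, so [A] is
    constant along the leaves, which are the fibres of [pi], and it is the pull-back of a
    bundle map [a] over [M] ([pairing_descends]); the same formula for arbitrary [X] says
    that [xi _| omega = - d a] ([pairing_exact]). Flatness gives [d (d a) = 0], hence
    [L_xi omega = d (xi _| omega) = 0] because [omega] is closed ([flat_exact_closed]).
    Finally, [theta] applied to the torsion identity of [xi'] yields
    [2 omega (xi e1, xi e2) = omega (xi e1, xi e2)] ([torsion_free_isotropic]).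

    Conversely, let [xi _| omega = - d a]. The pair [(d pi, theta)] maps each tangent space
    of [P] isomorphically, so there is a unique [xi'] with [d pi (xi' e) = xi e] and
    [theta (xi' e) = a e], and it is smooth ([exists_shear_lift]). It preserves [theta] by
    the computation above. Its torsion vanishes because its images under [theta] and [d pi]
    do: the first is a combination of values of [omega] on vectors [xi e]
    ([theta_shear_lift_torsion]), and the second reduces, in a frame pulled back from [M],
    to the torsion of [xi] ([proj_shear_lift_torsion]).

    Three facts of differential topology support this. Bump functions, built from
    [exp (- 1/t)], extend germs of sections to global ones ([extend_section]). A submersion
    has smooth local sections, by an inverse function theorem proved with the contraction
    principle ([local_section]); this gives the smoothness of [a]. Brackets of vector
    fields on [P] are projected to [M] with the symmetry of second derivatives ([schwarz],
    [mdiff_bracket]). *)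

(** * Smooth germs in Euclidean space *)

Section GermCalculus.
Context {R : realType}.

(** A single neighbourhood serves all orders of differentiability, so that smoothness
    at a point spreads to the nearby points. *)
Definition smooth_at n (V : normedModType R) (x : 'rV[R]_n) (f : 'rV[R]_n -> V) :=
  exists U, [/\ open U, U x & smooth_on U f].

Section Germs.
Variables (n : nat).
Implicit Types (x : 'rV[R]_n) (U : set 'rV[R]_n).

Lemma smooth_on_at (V : normedModType R) U x (f : 'rV[R]_n -> V) :
  open U -> U x -> smooth_on U f -> smooth_at x f.
Proof. by move=> oU Ux Cf; exists U. Qed.

Lemma smooth_at_on (V : normedModType R) U (f : 'rV[R]_n -> V) :
  (forall x, U x -> smooth_at x f) -> smooth_on U f.
Proof. by move=> H k; apply: Ck_local => x /H[W [_ Wx Cf]]; exists W. Qed.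

Lemma smooth_at_near (V : normedModType R) x (f : 'rV[R]_n -> V) :
  smooth_at x f -> \forall y \near x, smooth_at y f.
Proof.
move=> [U [oU Ux Cf]].
by apply: filterS (open_nbhs_nbhs (conj oU Ux)) => y Uy; exists U.
Qed.

Lemma smooth_at_eq (V : normedModType R) x (f g : 'rV[R]_n -> V) :
  {near x, f =1 g} -> smooth_at x f -> smooth_at x g.
Proof.
rewrite /prop_near1 nbhsE => -[W [oW Wx] fg] [U [oU Ux Cf]].
exists (U `&` W); split; [exact: openI|by []|].
move=> k; apply: Ck_eq (Ck_sub _ (Cf k)) => [||y [] //]; first exact: openI.
by move=> y; rewrite inE => -[_ /fg].
Qed.

Lemma smooth_at_ext (V : normedModType R) x (f g : 'rV[R]_n -> V) :
  f =1 g -> smooth_at x f -> smooth_at x g.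
Proof. by move=> /funext ->. Qed.

Lemma smooth_at_differentiable (V : normedModType R) x (f : 'rV[R]_n -> V) :
  smooth_at x f -> differentiable f x.
Proof. by move=> [U [_ Ux /(_ 1%N)[+ _]]]; apply. Qed.

Lemma smooth_at_continuous (V : normedModType R) x (f : 'rV[R]_n -> V) :
  smooth_at x f -> {for x, continuous f}.
Proof. by move=> /smooth_at_differentiable; exact: differentiable_continuous. Qed.

Lemma smooth_at_derive (V : normedModType R) x (f : 'rV[R]_n -> V) v :
  smooth_at x f -> smooth_at x ('D_v f).
Proof.
by move=> [U [oU Ux Cf]]; exists U; split=> // k; have [_ /(_ v)] := Cf k.+1.
Qed.

Lemma smooth_at_cst (V : normedModType R) x (a : V) : smooth_at x (cst a).
Proof. by exists setT; split=> //; [exact: openT|move=> k; exact: Ck_cst]. Qed.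

Lemma smooth_atD (V : normedModType R) x (f g : 'rV[R]_n -> V) :
  smooth_at x f -> smooth_at x g -> smooth_at x (fun y => f y + g y).
Proof.
move=> [U [oU Ux Cf]] [W [oW Wx Cg]]; exists (U `&` W); split=> //.
  exact: openI.
by move=> k; apply: CkD; [exact: openI|apply: Ck_sub (Cf k)|apply: Ck_sub (Cg k)] => y [].
Qed.

Lemma smooth_atZ (V : normedModType R) x (a : 'rV[R]_n -> R^o) (f : 'rV[R]_n -> V) :
  smooth_at x a -> smooth_at x f -> smooth_at x (fun y => (a y : R) *: f y).
Proof.
move=> [U [oU Ux Cf]] [W [oW Wx Cg]]; exists (U `&` W); split=> //.
  exact: openI.
by move=> k; apply: CkZ; [exact: openI|apply: Ck_sub (Cf k)|apply: Ck_sub (Cg k)] => y [].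
Qed.

Lemma smooth_atN (V : normedModType R) x (f : 'rV[R]_n -> V) :
  smooth_at x f -> smooth_at x (fun y => - f y).
Proof.
move=> sf; rewrite (_ : (fun y => _) = (fun y => (-1 : R) *: f y)).
  exact: smooth_atZ (smooth_at_cst x (-1 : R^o)) sf.
by apply/funext => y; rewrite scaleN1r.
Qed.

Lemma smooth_atB (V : normedModType R) x (f g : 'rV[R]_n -> V) :
  smooth_at x f -> smooth_at x g -> smooth_at x (fun y => f y - g y).
Proof. by move=> sf sg; apply: smooth_atD => //; exact: smooth_atN. Qed.

Lemma smooth_atM x (f g : 'rV[R]_n -> R^o) :
  smooth_at x f -> smooth_at x g -> smooth_at x (fun y => (f y * g y : R) : R^o).
Proof. exact: smooth_atZ. Qed.

Lemma smooth_at_sum (V : normedModType R) x (I : Type) (s : seq I) (P : pred I)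
    (f : I -> 'rV[R]_n -> V) :
  (forall i, P i -> smooth_at x (f i)) ->
  smooth_at x (fun y => \sum_(i <- s | P i) f i y).
Proof.
move=> H; elim: s => [|i s IH].
  by under eq_fun do rewrite big_nil; exact: smooth_at_cst.
case Pi: (P i); last by under eq_fun do rewrite big_cons Pi.
by under eq_fun do rewrite big_cons Pi; apply: smooth_atD => //; exact: H.
Qed.

Lemma smooth_at_prod x (I : Type) (s : seq I) (P : pred I)
    (f : I -> 'rV[R]_n -> R^o) :
  (forall i, P i -> smooth_at x (f i)) ->
  smooth_at x (fun y => (\prod_(i <- s | P i) (f i y : R) : R) : R^o).
Proof.
move=> H; elim: s => [|i s IH].
  by under eq_fun do rewrite big_nil; exact: smooth_at_cst.
case Pi: (P i); last by under eq_fun do rewrite big_cons Pi.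
by under eq_fun do rewrite big_cons Pi; apply: smooth_atM => //; exact: H.
Qed.

Lemma smooth_at_coord m x (f : 'rV[R]_n -> 'rV[R]_m) j :
  smooth_at x f -> smooth_at x (fun y => f y 0 j : R^o).
Proof. by move=> [U [oU Ux Cf]]; exists U; split=> // k; exact: Ck_coord (Cf k). Qed.

Lemma smooth_at_row m x (f : 'rV[R]_n -> 'rV[R]_m) :
  (forall j, smooth_at x (fun y => f y 0 j : R^o)) -> smooth_at x f.
Proof.
move=> H; rewrite (_ : f = fun y => \sum_j f y 0 j *: delta_mx 0 j).
  by apply: smooth_at_sum => j _; apply: smooth_atZ (smooth_at_cst _ _); exact: H.
by apply/funext => y; rewrite {1}[f y]row_sum_delta.
Qed.

Lemma smooth_at_comp m (V : normedModType R) x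
    (f : 'rV[R]_n -> 'rV[R]_m) (g : 'rV[R]_m -> V) :
  smooth_at x f -> smooth_at (f x) g -> smooth_at x (fun y => g (f y)).
Proof.
move=> sf [W [oW Wx Cg]].
have := smooth_at_continuous sf (open_nbhs_nbhs (conj oW Wx)).
rewrite nbhsE => -[U1 [oU1 U1x] fU1]; case: sf => U [oU Ux Cf].
exists (U `&` U1); split=> //; first exact: openI.
move=> k; apply: (@Ck_comp _ _ _ _ _ _ W) (Cg k); first exact: openI.
  by move=> y [_ /fU1].
by apply: Ck_sub (Cf k) => y [].
Qed.

Lemma smooth_at_id x : smooth_at x (id : 'rV[R]_n -> 'rV[R]_n).
Proof.
exists setT; split=> //; first exact: openT.
case=> [|k]; first by move=> y _; exact: cvg_id.
split=> // v; rewrite (_ : 'D_v id = cst v); first exact: Ck_cst.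
by apply/funext => y; rewrite derive_id.
Qed.

Lemma smooth_at_derive_along (V : normedModType R) x (X : 'rV[R]_n -> 'rV[R]_n)
    (f : 'rV[R]_n -> V) :
  smooth_at x X -> smooth_at x f -> smooth_at x (fun y => 'D_(X y) f y).
Proof.
move=> sX sf; apply: (@smooth_at_eq _ _ (fun y => \sum_j X y 0 j *: 'D_(delta_mx 0 j) f y)).
  apply: filterS (smooth_at_near sf) => y /smooth_at_differentiable dy.
  by rewrite -derive_sum_coord.
apply: smooth_at_sum => j _; apply: smooth_atZ; first exact: smooth_at_coord.
exact: smooth_at_derive.
Qed.

(** The formula [D_v (1/f) = - (1/f)^2 D_v f] expresses the derivative of [1/f] through
    [1/f] itself, so each order of smoothness yields the next one. *)
Lemma Ck_inv k U (f : 'rV[R]_n -> R^o) : open U -> (forall y, U y -> f y != 0) ->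
  Ck k U f -> Ck k U (fun y => (f y : R)^-1 : R^o).
Proof.
move=> oU f0; elim: k => [|k IH].
  by move=> cf y Uy; apply: (@continuousV R _ (f : _ -> R)) => //; [exact: f0 _ Uy|exact: cf].
move=> Cf; have Ci := IH (CkS Cf); case: Cf => df Cdf; split=> [y Uy|v].
  by apply: differentiableV; [exact: df|exact: f0].
have C2 : Ck k U (fun y => - ((f y : R)^-1 * ((f y : R)^-1 * 'D_v f y)) : R^o).
  have := CkZ oU Ci (CkZ oU Ci (Cdf v)).
  move=> /(CkZ oU (Ck_cst k U (-1 : R^o))); apply: Ck_eq => // y _.
  by rewrite scaleN1r.
apply: Ck_eq C2 => // y; rewrite inE => Uy.
have Dy : derivable f y v by apply: diff_derivable; exact: df.
rewrite deriveV; [|exact: f0|by []].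
by rewrite expr2 invfM scaleNr /GRing.scale/= -mulrA.
Qed.

Lemma smooth_at_neq0 x (f : 'rV[R]_n -> R^o) : smooth_at x f -> f x != 0 ->
  \forall y \near x, f y != 0.
Proof.
move=> sf f0; have o0 : open ([set z | z != 0] : set R^o) by exact: (@open_neq R 0).
exact: smooth_at_continuous sf _ (open_nbhs_nbhs (conj o0 f0)).
Qed.

Lemma smooth_at_inv x (f : 'rV[R]_n -> R^o) : smooth_at x f -> f x != 0 ->
  smooth_at x (fun y => (f y : R)^-1 : R^o).
Proof.
move=> sf f0; have := smooth_at_neq0 sf f0.
rewrite /prop_near1 nbhsE => -[W [oW Wx] fW]; case: sf => U [oU Ux Cf].
exists (U `&` W); split=> //; first exact: openI.
move=> k; apply: Ck_inv; first exact: openI.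
  by move=> y [_ /fW].
by apply: Ck_sub (Cf k) => y [].
Qed.

Lemma smooth_at_det m x (A : 'rV[R]_n -> 'M[R]_m) :
  (forall i j, smooth_at x (fun y => A y i j : R^o)) ->
  smooth_at x (fun y => \det (A y) : R^o).
Proof.
move=> sA; apply: smooth_at_sum => s _; apply: smooth_atM (smooth_at_cst _ _) _.
by apply: smooth_at_prod => i _; exact: sA.
Qed.

(** By Cramer's rule the entries of the inverse are quotients of determinants. *)
Lemma smooth_at_invmx m x (A : 'rV[R]_n -> 'M[R]_m) : A x \in unitmx ->
  (forall i j, smooth_at x (fun y => A y i j : R^o)) ->
  forall i j, smooth_at x (fun y => invmx (A y) i j : R^o).
Proof.
move=> uA sA i j; have sd := smooth_at_det sA.
have d0 : \det (A x) != 0 by rewrite -unitfE -unitmxE.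
apply: (@smooth_at_eq _ _ (fun y => ((\det (A y))^-1 * (\adj (A y)) i j : R) : R^o)).
  apply: filterS (smooth_at_neq0 sd d0) => y dy.
  by rewrite /invmx unitmxE unitfE dy [RHS]mxE.
apply: smooth_atM; first exact: smooth_at_inv.
apply: (@smooth_at_ext _ _ (fun y => cofactor (A y) j i : R^o)).
  by move=> y; rewrite mxE.
apply: (@smooth_atM _ (cst ((-1) ^+ (j + i))) (fun y => \det (row' j (col' i (A y))))).
  exact: smooth_at_cst.
apply: smooth_at_det => k l.
apply: (@smooth_at_ext _ _ (fun y => A y (lift j k) (lift i l) : R^o)).
  by move=> y; rewrite !mxE.
exact: sA.
Qed.

Lemma smooth_at_mulmx m p x (u : 'rV[R]_n -> 'rV[R]_m) (A : 'rV[R]_n -> 'M[R]_(m, p)) :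
  smooth_at x u -> (forall i j, smooth_at x (fun y => A y i j : R^o)) ->
  smooth_at x (fun y => u y *m A y).
Proof.
move=> su sA; apply: smooth_at_row => j.
apply: (@smooth_at_ext _ _ (fun y => \sum_i (u y 0 i * A y i j : R) : R^o)).
  by move=> y; rewrite mxE.
by apply: smooth_at_sum => i _; apply: smooth_atM => //; exact: smooth_at_coord.
Qed.

End Germs.
End GermCalculus.

(** * Mean values and symmetry of second derivatives *)

Section SecondOrder.
Context {R : realType}.

Lemma derivable_line (V W : normedModType R) (f : V -> W) x v (t : R) :
  derivable f (x + t *: v) v ->
  is_derive t 1 (fun s : R => f (x + s *: v)) ('D_v f (x + t *: v)).
Proof.
move=> df.
have E : (fun h : R => h^-1 *: (((fun s : R => f (x + s *: v)) \o shift t) (h *: 1)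
           - f (x + t *: v))) =
         (fun h : R => h^-1 *: ((f \o shift (x + t *: v)) (h *: v) - f (x + t *: v))).
  apply/funext => h /=; congr (_ *: (f _ - _)).
  by rewrite scalerDl addrCA [h *: 1]mulr1.
by apply: DeriveDef; rewrite /derivable /derive /= E.
Qed.

Lemma mvt_line (V : normedModType R) (f : V -> R^o) x v :
  (forall t : R, 0 <= t <= 1 -> differentiable f (x + t *: v)) ->
  exists2 t : R, 0 <= t <= 1 & f (x + v) - f x = 'D_v f (x + t *: v).
Proof.
move=> df.
have dl (t : R) : 0 <= t <= 1 ->
    is_derive t 1 (fun s : R => f (x + s *: v)) ('D_v f (x + t *: v)).
  by move=> /df dt; apply: derivable_line; exact: diff_derivable.
have [||c] := @MVT_segment R (fun s : R => f (x + s *: v) : R)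
    (fun s => 'D_v f (x + s *: v)) 0 1 ler01.
- by move=> t; rewrite in_itv /= => /andP[t0 t1]; apply: dl; rewrite !ltW.
- apply: derivable_within_continuous => t; rewrite in_itv /= => /dl dt.
  exact: ex_derive.
rewrite in_itv /= scale1r scale0r addr0 subr0 mulr1 => c01 ->.
by exists c.
Qed.

Lemma derive_scalev (V W : normedModType R) (f : V -> W) x (a : R) v :
  differentiable f x -> 'D_(a *: v) f x = a *: 'D_v f x.
Proof. by move=> df; rewrite !deriveE// linearZ. Qed.

Lemma derive_addv (V W : normedModType R) (f : V -> W) x u v :
  differentiable f x -> 'D_(u + v) f x = 'D_u f x + 'D_v f x.
Proof. by move=> df; rewrite !deriveE// linearD. Qed.

Lemma derive_coord (V : normedModType R) m (f : V -> 'rV[R]_m) x v j :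
  differentiable f x ->
  differentiable (fun y => f y 0 j : R^o) x /\
  'D_v (fun y => f y 0 j : R^o) x = 'D_v f x 0 j.
Proof.
move=> df.
have lin : linear (fun N : 'rV[R]_m => N 0 j : R^o) by move=> a u w; rewrite !mxE.
pose lM := GRing.isLinear.Build _ _ _ _ _ lin.
pose L : {linear 'rV[R]_m -> R^o} := HB.pack (fun N : 'rV[R]_m => N 0 j : R^o) lM.
have cL : continuous L by exact: coord_continuous.
have dL y : differentiable L y by exact: linear_differentiable.
split; first exact: (@differentiable_comp _ _ _ _ f L).
by rewrite (@derive_chain _ _ _ _ f L x v df (dL _)) derive_lin.
Qed.

Lemma ball_convex (V : normedModType R) (x a b : V) e (t : R) : 0 <= t <= 1 ->
  ball x e a -> ball x e b -> ball x e (a + t *: (b - a)).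
Proof.
move=> /andP[t0 t1]; rewrite -ball_normE /= => xa xb.
have -> : x - (a + t *: (b - a)) = (1 - t) *: (x - a) + t *: (x - b).
  rewrite scalerBl scale1r -[RHS]addrA [- _ + _]addrC -scalerBr.
  have -> : x - b - (x - a) = - (b - a) by rewrite !opprB addrC subrKA.
  by rewrite opprD addrA scalerN.
apply: le_lt_trans (ler_normD _ _) _; rewrite !normrZ !ger0_norm ?subr_ge0//.
have mb : Num.max `|x - a| `|x - b| < e by rewrite gt_max xa.
apply: le_lt_trans mb; set m := Num.max _ _.
rewrite (_ : m = (1 - t) * m + t * m); last by ring.
by rewrite lerD// ler_wpM2l ?subr_ge0// /m le_max lexx ?orbT.
Qed.

(** The mean value theorem, applied along [u] and then along [v], writes the second
    difference of [f] over a small parallelogram as a mixed second derivative. *)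
Lemma second_difference n (f : 'rV[R]_n -> R^o) (x : 'rV[R]_n) e u v (t : R) :
  (forall y, ball x e y -> smooth_at y f) ->
  0 <= t -> t * (`|u| + `|v|) < e ->
  exists2 y, ball x e y &
    f (x + t *: u + t *: v) - f (x + t *: u) - (f (x + t *: v) - f x) =
    t ^+ 2 * 'D_v ('D_u f) y.
Proof.
move=> sf t0 te.
have inball (a b : R) : 0 <= a <= 1 -> 0 <= b <= 1 ->
    ball x e (x + a *: (t *: u) + b *: (t *: v)).
  move=> /andP[a0 a1] /andP[b0 b1]; rewrite -ball_normE /= -addrA opprD addrA subrr sub0r.
  rewrite normrN; apply: le_lt_trans te; apply: le_trans (ler_normD _ _) _.
  rewrite !normrZ mulrDr !(ger0_norm t0) !ger0_norm// lerD// ler_piMl//.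
    exact: mulr_ge0.
  exact: mulr_ge0.
have [e0 e1] : 0 <= (0:R) <= 1 /\ 0 <= (1:R) <= 1 by rewrite !lexx !ler01.
have inball1 (a : R) : 0 <= a <= 1 -> ball x e (x + a *: (t *: u)).
  by move=> ha; have := inball a 0 ha e0; rewrite scale0r addr0.
pose g y := f (y + t *: v) - f y.
have sh y : differentiable f (y + t *: v) ->
    differentiable (fun z => f (z + t *: v)) y /\
    'D_(t *: u) (fun z => f (z + t *: v)) y = 'D_(t *: u) f (y + t *: v).
  move=> df; have ds : differentiable (fun z : 'rV[R]_n => z + t *: v) y by [].
  split; first exact: (@differentiable_comp _ _ _ _ (fun z => z + t *: v) f).
  rewrite (@derive_chain _ _ _ _ (fun z => z + t *: v) f _ _ ds df); congr ('D_ _ f _).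
  by rewrite deriveD ?derive_cst ?addr0 ?derive_id//; exact: diff_derivable.
have dg (c : R) : 0 <= c <= 1 -> differentiable g (x + c *: (t *: u)) /\
   'D_(t *: u) g (x + c *: (t *: u)) =
   'D_(t *: u) f (x + c *: (t *: u) + t *: v) - 'D_(t *: u) f (x + c *: (t *: u)).
  move=> hc; have d0 := smooth_at_differentiable (sf _ (inball1 c hc)).
  have := smooth_at_differentiable (sf _ (inball c 1 hc e1)); rewrite scale1r.
  move=> /sh[d1 E]; split; first exact: differentiableB.
  by rewrite deriveB ?E//; exact: diff_derivable.
(* The increment of [g] along [t u], then the increment of its derivative along [t v]. *)
have [c hc] := @mvt_line _ g x (t *: u) (fun c hc => (dg c hc).1).
rewrite (dg c hc).2 /g => ->.
rewrite !derive_scalev; first last.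
- by have := smooth_at_differentiable (sf _ (inball c 1 hc e1)); rewrite scale1r.
- exact: smooth_at_differentiable (sf _ (inball1 c hc)).
have dd (d : R) : 0 <= d <= 1 ->
    differentiable ('D_u f : _ -> R^o) (x + c *: (t *: u) + d *: (t *: v)).
  move=> hd; apply: smooth_at_differentiable; apply: smooth_at_derive.
  exact/sf/inball.
have [d hd] := @mvt_line _ ('D_u f : _ -> R^o) _ (t *: v) dd.
rewrite -scalerBr => ->; rewrite derive_scalev; last exact: dd.
exists (x + c *: (t *: u) + d *: (t *: v)); first exact: inball.
by rewrite expr2 -mulrA.
Qed.

Lemma dist_le_half (a b c e : R) : `|a - c| < e / 2 -> `|b - c| < e / 2 ->
  `|a - b| <= e.
Proof.
move=> ac bc; rewrite -(subrK c a) -addrA; apply: le_trans (ler_normD _ _) _.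
by rewrite (splitr e) lerD// ltW// distrC.
Qed.

(** The second difference is symmetric in [u] and [v]; shrinking the parallelogram
    identifies the two mixed derivatives, by continuity. *)
Lemma schwarz1 n (f : 'rV[R]_n -> R^o) (x u v : 'rV[R]_n) : smooth_at x f ->
  'D_v ('D_u f) x = 'D_u ('D_v f) x.
Proof.
move=> sf; apply/eqP; rewrite -subr_eq0 -normr_le0; apply/ler_addgt0Pr => e e0.
rewrite add0r.
have e20 : 0 < e / 2 by rewrite divr_gt0.
pose fu := 'D_v ('D_u f); pose fv := 'D_u ('D_v f).
have c1 : \forall y \near x, ball (fu x) (e / 2) (fu y).
  apply: (smooth_at_continuous (smooth_at_derive v (smooth_at_derive u sf))).
  exact: nbhsx_ballx.
have c2 : \forall y \near x, ball (fv x) (e / 2) (fv y).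
  apply: (smooth_at_continuous (smooth_at_derive u (smooth_at_derive v sf))).
  exact: nbhsx_ballx.
have H3 : nbhs x [set y | [/\ smooth_at y f, ball (fu x) (e / 2) (fu y)
  & ball (fv x) (e / 2) (fv y)]].
  by move: (smooth_at_near sf) c1 c2; apply: filterS3.
have [d /= d0 H] := (nbhs_ballP x _).1 H3.
pose t := d / (`|u| + `|v| + 1).
have s0 : 0 < `|u| + `|v| + 1 by rewrite ltr_wpDl// addr_ge0.
have t0 : 0 < t by rewrite divr_gt0.
have td : t * (`|u| + `|v|) < d.
  by rewrite mulrAC ltr_pdivrMr// ltr_pM2l// ltrDl.
have sB y : ball x d y -> smooth_at y f by move=> /H[].
have [y1 /H[_ B1 _] E1] := second_difference sB (ltW t0) td.
rewrite addrC in td.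
have [y2 /H[_ _ B2] E2] := second_difference sB (ltW t0) td.
have E : 'D_v ('D_u f) y1 = 'D_u ('D_v f) y2.
  have tn0 : t ^+ 2 != 0 by rewrite expf_eq0 /= gt_eqF.
  apply: (mulfI tn0); apply: etrans (esym E1) (etrans _ E2).
  rewrite (addrAC x (t *: v)).
  by rewrite !opprB addrACA [in RHS]addrACA; congr (_ + _); rewrite addrC.
by move: B1 B2; rewrite -!ball_normE /= /fu E; exact: dist_le_half.
Qed.

Lemma schwarz n m (f : 'rV[R]_n -> 'rV[R]_m) (x u v : 'rV[R]_n) : smooth_at x f ->
  'D_v ('D_u f) x = 'D_u ('D_v f) x.
Proof.
move=> sf.
have E a b j : 'D_a ('D_b f) x 0 j = 'D_a ('D_b (fun y => f y 0 j : R^o)) x.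
  have [_ <-] := @derive_coord _ _ ('D_b f) x a j
    (smooth_at_differentiable (smooth_at_derive b sf)).
  apply: near_eq_derive; apply: filterS (smooth_at_near sf) => y sy.
  by have [_ ->] := @derive_coord _ _ f y b j (smooth_at_differentiable sy).
apply/rowP => j; apply: etrans (E v u j) (etrans _ (esym (E u v j))).
exact/schwarz1/smooth_at_coord.
Qed.

End SecondOrder.

(** * Bump functions *)

Section Bump.
Context {R : realType}.

(** Unlike [exp (- 1/t)] alone, this family is closed under differentiation, up to
    linear combinations. *)
Definition flat (k : nat) (t : R) : R :=
  if 0 < t then t^-1 ^+ k * expR (- t^-1) else 0.

Definition dflat (k : nat) (t : R) : R := flat k.+2 t - k%:R * flat k.+1 t.

Lemma flat_gt0 t : 0 < t -> 0 < flat 0 t.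
Proof. by move=> t0; rewrite /flat t0 expr0 mul1r expR_gt0. Qed.

Lemma flat_ge0 t : 0 <= flat 0 t.
Proof. by rewrite /flat; case: ifP => // t0; rewrite expr0 mul1r expR_ge0. Qed.

Lemma flat0 k t : t <= 0 -> flat k t = 0.
Proof. by rewrite /flat ltNge => ->. Qed.

Lemma expR_ge_pow (k : nat) (s : R) : 0 <= s -> (s / k.+1%:R) ^+ k.+1 <= expR s.
Proof.
move=> s0; have -> : expR s = expR (s / k.+1%:R) ^+ k.+1.
  by rewrite -expRM_natl mulr_natl -mulr_natr divfK// pnatr_eq0.
have s1 : 0 <= s / k.+1%:R by rewrite divr_ge0.
rewrite lerXn2r ?nnegrE ?expR_ge0//; apply: le_trans (expR_ge1Dx _).
by rewrite lerDr.
Qed.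

(** Since [exp s >= (s / m)^m] for [m = k + 2], the product [s^k exp (- s)] is at most
    [m^m / s^2]; take [s = 1/t]. *)
Lemma flat_le_sqr k t : `|flat k t| <= k.+2%:R ^+ k.+2 * t ^+ 2.
Proof.
rewrite /flat; case: ifPn => [t0|_]; last by rewrite normr0 mulr_ge0 ?sqr_ge0// exprn_ge0.
have s0 : 0 < t^-1 by rewrite invr_gt0.
rewrite ger0_norm; last by rewrite mulr_ge0 ?expR_ge0// exprn_ge0// ltW.
rewrite expRN ler_pdivrMr ?expR_gt0//.
have := expR_ge_pow k.+1 (ltW s0); rewrite exprMn (exprVn _%:R).
set N := (k.+2%:R ^+ k.+2 : R); have N0 : 0 < N by rewrite exprn_gt0.
move=> H; apply: (@le_trans _ _ (N * t ^+ 2 * (t^-1 ^+ k.+2 / N))); last first.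
  by rewrite ler_pM2l// mulr_gt0// exprn_gt0.
rewrite le_eqVlt; apply/orP; left; apply/eqP.
rewrite -[k.+2]addn2 exprD; have t00 : t != 0 by rewrite gt_eqF.
have N00 : N != 0 by rewrite gt_eqF.
by rewrite !exprVn; field; rewrite t00 N00 expf_neq0.
Qed.

(** At [0], the quadratic bound makes the difference quotients tend to [0]. *)
Lemma is_derive_flat k (t : R) : is_derive t 1 (flat k) (dflat k t).
Proof.
have [t0|t0|->] := ltgtP t 0.
- rewrite /dflat !flat0 ?ltW// mulr0 subr0.
  apply: (@near_eq_is_derive _ _ _ (cst 0)).
  by near=> y; rewrite flat0// ltW//; near: y; exact: lt_nbhsl.
- have -> : dflat k t = (k%:R * t^-1 ^+ k.-1 * (- t ^- 2)) * expR (- t^-1) +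
      t^-1 ^+ k * (expR (- t^-1) * t ^- 2).
    rewrite /dflat /flat t0; case: k => [|k]; first by field; rewrite gt_eqF.
    rewrite /= !exprVn !exprS; field; rewrite gt_eqF//=.
    by rewrite expf_neq0// gt_eqF.
  apply: (@near_eq_is_derive R R^o R^o (fun y : R => y^-1 ^+ k * expR (- y^-1))).
    by near=> y; rewrite /flat ifT//; near: y; exact: lt_nbhsr.
  have tn : t != 0 by rewrite gt_eqF.
  have dV : is_derive t 1 (fun y : R => y^-1) (- t ^- 2).
    apply: DeriveDef; first exact: (@derivableV _ _ id).
    by rewrite (@deriveV _ _ id)// derive_id [LHS]mulr1.
  have dE : is_derive t 1 (fun y : R => expR (- y^-1)) (expR (- t^-1) * t ^- 2).
    apply: is_derive_eq.
    by rewrite opprK.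
  have dP := @is_deriveX _ _ (fun y : R => y^-1) k t 1 _ dV.
  have := @is_deriveM _ _ _ _ t 1 _ _ dP dE.
  have -> : (fun y : R => y^-1) ^+ k * (fun y : R => expR (- y^-1)) =
            (fun y : R => y^-1 ^+ k * expR (- y^-1)).
    by apply/funext => y; rewrite [LHS]/= exprfctE.
  move=> H; apply: is_derive_eq.
  by rewrite exprfctE /GRing.scale/= addrC [in RHS]mulrC.
- rewrite /dflat !flat0// mulr0 subr0.
  set C : R := k.+2%:R ^+ k.+2; have C0 : 0 < C by rewrite exprn_gt0.
  have cv : (fun h : R => h^-1 *: ((flat k \o shift 0) (h *: 1) - flat k 0)) @ 0^' --> (0 : R).
    apply/cvgr0Pnorm_lt => e e0; near=> h.
    rewrite /= (flat0 k (lexx 0)) subr0 addr0 [h *: 1]mulr1 normrM normfV.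
    have h0 : h != 0 by near: h; exact: nbhs_dnbhs_neq.
    rewrite mulrC ltr_pdivrMr ?normr_gt0//; apply: le_lt_trans (flat_le_sqr k h) _.
    rewrite -/C -real_normK ?num_real// expr2 mulrA ltr_pM2r ?normr_gt0//.
    rewrite mulrC -ltr_pdivlMr//.
    by near: h; apply: dnbhs0_lt; rewrite divr_gt0.
  by apply: DeriveDef; [apply: cvgP cv|exact: cvg_lim cv].
Unshelve. all: by end_near. Qed.

(** Each derivative is a combination of functions of the same family, so the order of
    smoothness is raised for all [k] at once. *)
Lemma Ck_flat n k m (U : set 'rV[R]_n) (u : 'rV[R]_n -> R^o) : open U -> Ck m U u ->
  Ck m U (fun y => flat k (u y) : R^o).
Proof.
have df j (t : R) : differentiable (flat j : R^o -> R^o) t.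
  by apply/derivable1_diffP; have [] := is_derive_flat j t.
move=> oU; elim: m k => [|m IH] k.
  move=> cu y Uy; apply: continuous_comp; first exact: cu.
  exact/differentiable_continuous.
move=> Cu; have Cu' := CkS Cu; case: Cu => du Cdu; split=> [y Uy|v].
  exact: (@differentiable_comp _ _ _ _ u (flat k : R^o -> R^o) y (du _ Uy) (df _ _)).
have C2 : Ck m U (fun y => (flat k.+2 (u y) - k%:R * flat k.+1 (u y)) *: 'D_v u y).
  have C3 : Ck m U (fun y => - (k%:R * flat k.+1 (u y)) : R^o).
    have := CkZ oU (Ck_cst m U (- k%:R : R^o)) (IH k.+1 Cu').
    by apply: Ck_eq => // y _; rewrite /GRing.scale/= mulNr.
  exact: CkZ oU (CkD oU (IH k.+2 Cu') C3) (Cdu v).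
apply: Ck_eq C2 => // y; rewrite inE => Uy.
rewrite (@derive_chain _ _ _ _ u (flat k : R^o -> R^o) y v (du _ Uy) (df _ _)).
have E (w : R) s : 'D_w (flat k : R^o -> R^o) s = dflat k s * w.
  have := @derive_scalev _ _ _ (flat k : R^o -> R^o) s w (1 : R^o) (df k s).
  rewrite [w *: _]mulr1 => ->; rewrite [RHS]mulrC; congr (_ * _).
  by have [] := is_derive_flat k s.
by rewrite E.
Qed.

Lemma smooth_at_flat n k (x : 'rV[R]_n) (u : 'rV[R]_n -> R^o) : smooth_at x u ->
  smooth_at x (fun y => flat k (u y) : R^o).
Proof. by move=> [U [oU Ux Cu]]; exists U; split=> // m; exact: Ck_flat. Qed.

(** With [u] the squared distance to [x0], the quotient of [flat 0 (2 eta - u)] by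
    [flat 0 (2 eta - u) + flat 0 (u - eta)] is [1] where [u <= eta] and [0] where
    [u >= 2 eta]; one of the two terms of the denominator is always positive. *)
Lemma bump_rV n (x0 : 'rV[R]_n) (e : R) : 0 < e ->
  exists b : 'rV[R]_n -> R^o, [/\ forall y, smooth_at y b,
    \forall y \near x0, b y = 1 & forall y, ~ ball x0 e y -> b y = 0].
Proof.
(* [2 eta = e^2], so that [u y < 2 eta] keeps every coordinate of [y] within [e]. *)
move=> e0; pose eta := e ^+ 2 / 2; have eta0 : 0 < eta by rewrite divr_gt0// exprn_gt0.
pose u (y : 'rV[R]_n) : R^o := \sum_j (y 0 j - x0 0 j : R) ^+ 2.
have su y : smooth_at y u.
  apply: smooth_at_sum => j _; have sj : smooth_at y (fun z => z 0 j - x0 0 j : R^o).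
    apply: smooth_atB; last exact: smooth_at_cst.
    by apply: (@smooth_at_coord _ _ _ _ id); exact: smooth_at_id.
  by apply: smooth_at_ext (smooth_atM sj sj) => z; rewrite expr2.
pose g1 y : R^o := flat 0 (2 * eta - u y); pose g2 y : R^o := flat 0 (u y - eta).
have s1 y : smooth_at y g1.
  by apply: smooth_at_flat; apply: smooth_atB => //; exact: smooth_at_cst.
have s2 y : smooth_at y g2.
  by apply: smooth_at_flat; apply: smooth_atB => //; exact: smooth_at_cst.
have g0 y : 0 < g1 y + g2 y.
  have [uy|uy] := ltP (u y) (2 * eta).
    by rewrite ltr_pwDl// ?flat_ge0// flat_gt0// subr_gt0.
  by rewrite ltr_pwDr// ?flat_ge0// flat_gt0// subr_gt0 (lt_le_trans _ uy)// ltr_pMl// ltr1n.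
exists (fun y => (g1 y * (g1 y + g2 y)^-1 : R) : R^o); split.
- move=> y; apply: smooth_atM => //; apply: smooth_at_inv; first exact: smooth_atD.
  by rewrite gt_eqF.
- have ux0 : u x0 < eta by rewrite /u big1// => j _; rewrite subrr expr0n.
  have N : \forall y \near x0, u y < eta.
    exact: smooth_at_continuous (su x0) _ (lt_nbhsl ux0 : nbhs (u x0 : R^o) _).
  apply: filterS N => y uy.
  have g20 : g2 y = 0 by rewrite /g2 flat0// subr_le0 ltW.
  by have := g0 y; rewrite g20 addr0 => g1y; rewrite divff// gt_eqF.
- move=> y nb; rewrite [g1 y](_ : _ = 0) ?mul0r//.
  apply: flat0; rewrite subr_le0 leNgt; apply/negP => uy; apply: nb; split=> // i j.
  rewrite ord1 /ball /=; rewrite -(@ltr_pXn2r _ 2)// ?nnegrE// ?ltW//.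
  rewrite real_normK ?num_real// -sqrrN opprB.
  apply: le_lt_trans (_ : _ <= u y) _.
    by rewrite /u (bigD1 j)//= lerDl sumr_ge0// => i' _; exact: sqr_ge0.
  by apply: lt_le_trans uy _; rewrite /eta mulrC divfK ?lexx// pnatr_eq0.
Qed.

End Bump.

(** * Local inverses and local sections *)

Section InverseFunction.
Context {R : realType}.

Lemma rV_norm_coord n (v : 'rV[R]_n) j : `|v 0 j| <= `|v|.
Proof.
rewrite [leRHS]mx_normrE; exact: (le_bigmax _ (fun i : 'I_1 * 'I_n => `|v i.1 i.2|) (0, j)).
Qed.

Lemma rV_norm_le n (v : 'rV[R]_n) c : 0 <= c -> (forall j, `|v 0 j| <= c) -> `|v| <= c.
Proof.
move=> c0 H; rewrite [leLHS]mx_normrE; apply: bigmax_le => // -[i j] _ /=.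
by rewrite ord1.
Qed.

Lemma differentiable_intro (V W : normedModType R) (f : V -> W) x (L : {linear V -> W}) :
  continuous L ->
  (forall e, 0 < e -> \forall h \near 0, `|f (h + x) - (f x + L h)| <= e * `|h|) ->
  differentiable f x /\ forall v, 'D_v f x = L v.
Proof.
move=> cL H.
have dg : f \o shift x = cst (f x) + L +o_ 0 id by apply/eqaddoP => e e0; exact: H.
have dE : 'd f x = L :> (V -> W) by exact: diff_unique dg.
have df : differentiable f x by apply/diff_locallyP; rewrite dE.
by split=> // v; rewrite deriveE// dE.
Qed.

Lemma differentiable_elim (V W : normedModType R) (f : V -> W) x e :
  differentiable f x -> 0 < e ->
  \forall h \near 0, `|f (h + x) - (f x + 'D_h f x)| <= e * `|h|.
Proof.
move=> df e0; have := diff_locally df; move/eqaddoP => /(_ e e0).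
by apply: filterS => h; rewrite deriveE.
Qed.

Lemma mulmxr_continuous m n (B : 'M[R]_(m, n)) :
  continuous (mulmxr B : 'rV[R]_m -> 'rV[R]_n).
Proof.
move=> v; apply: smooth_at_continuous; apply: smooth_at_mulmx.
  exact: smooth_at_id.
by move=> i j; exact: smooth_at_cst.
Qed.

Lemma near0_ball (V : normedModType R) (P : set V) : (\forall x \near 0, P x) ->
  exists2 d : R, 0 < d & forall x, `|x| < d -> P x.
Proof.
move=> /nbhs_ballP[d /= d0 H]; exists d => // x xd; apply: H.
by rewrite -ball_normE /= sub0r normrN.
Qed.

(** The partial derivatives of [id - F] vanish at [0], hence are at most
    [1 / (2 (n + 1))] near [0]; the mean value theorem turns this into a Lipschitz bound
    for the sup norm. *)
Lemma near_id_lipschitz n (F : 'rV[R]_n -> 'rV[R]_n) : smooth_at 0 F ->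
  (forall v, 'D_v F 0 = v) ->
  exists2 d : R, 0 < d &
    (forall x, `|x| < d -> smooth_at x F) /\
    forall x y, `|x| < d -> `|y| < d -> `|(x - F x) - (y - F y)| <= `|x - y| / 2.
Proof.
move=> sF dF; pose e : R := (n.+1%:R)^-1 / 2.
have e0 : 0 < e by rewrite divr_gt0// invr_gt0.
pose phi (j : 'I_n) (x : 'rV[R]_n) : R^o := x 0 j - F x 0 j.
have sphi x j : smooth_at x F -> smooth_at x (phi j).
  move=> sFx; apply: smooth_atB; last exact: smooth_at_coord.
  by apply: (@smooth_at_coord _ _ _ _ id); exact: smooth_at_id.
have dphi0 j v : 'D_v (phi j) 0 = 0.
  have d0 := smooth_at_differentiable sF.
  have [d1 E1] := derive_coord v j d0.
  have [d2 E2] := @derive_coord _ _ _ id (0 : 'rV[R]_n) v j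
    (smooth_at_differentiable (@smooth_at_id R n 0)).
  by rewrite deriveB ?E1 ?E2 ?dF ?derive_id ?subrr//; exact: diff_derivable.
have near_small j i : \forall x \near (0 : 'rV[R]_n), `|'D_(delta_mx 0 i) (phi j) x| < e.
  have c := smooth_at_continuous (smooth_at_derive (delta_mx 0 i) (sphi 0 j sF)).
  have N : \forall x \near (0 : 'rV[R]_n),
      ball ('D_(delta_mx 0 i) (phi j) 0) e ('D_(delta_mx 0 i) (phi j) x).
    by apply: c; exact: nbhsx_ballx.
  by apply: filterS N => x; rewrite -ball_normE /= dphi0 sub0r normrN.
have /near0_ball[d d0 H] : \forall x \near (0 : 'rV[R]_n), smooth_at x F /\
    forall j i, `|'D_(delta_mx 0 i) (phi j) x| < e.
  have N2 j : \forall x \near (0 : 'rV[R]_n), forall i, `|'D_(delta_mx 0 i) (phi j) x| < e.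
    exact: filter_forall (near_small j).
  have N3 : \forall x \near (0 : 'rV[R]_n), forall j i, `|'D_(delta_mx 0 i) (phi j) x| < e.
    exact: filter_forall N2.
  by apply: filterS2 (smooth_at_near sF) N3 => x.
exists d => //; split=> [x /H[]//|x y xd yd].
apply: rV_norm_le => [|j]; first by rewrite divr_ge0.
pose v := x - y.
have inb (t : R) : 0 <= t <= 1 -> `|y + t *: v| < d.
  move=> ht; have inbN (z : 'rV[R]_n) : `|z| < d -> ball 0 d z.
    by rewrite -ball_normE /= sub0r normrN.
  by have := ball_convex ht (inbN _ yd) (inbN _ xd); rewrite -ball_normE /= sub0r normrN.
have dphi (t : R) : 0 <= t <= 1 -> differentiable (phi j) (y + t *: v).
  by move=> /inb/H[sFt _]; apply: smooth_at_differentiable; exact: sphi.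
have [t ht] := mvt_line dphi.
have -> : y + v = x by rewrite /v addrCA subrr addr0.
have -> : (x - F x - (y - F y)) 0 j = phi j x - phi j y by rewrite /phi !mxE.
move=> ->; rewrite derive_sum_coord; last exact: dphi.
apply: le_trans (ler_norm_sum _ _ _) _.
apply: (@le_trans _ _ (\sum_(i < n) `|v| * e)).
  apply: ler_sum => i _; rewrite normrM ler_pM ?rV_norm_coord//.
  by have [_ /(_ j i)/ltW] := H _ (inb t ht).
rewrite sumr_const card_ord -mulrnAr ler_wpM2l// /e -mulrnAl -[_ *+ n]mulr_natl.
by rewrite ler_piMl ?invr_ge0// ler_pdivrMr// mul1r ler_nat.
Qed.

Section LocalInverse.
Variables (n : nat) (F : 'rV[R]_n -> 'rV[R]_n) (d : R).
Hypothesis d0 : 0 < d.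
Hypothesis F0 : F 0 = 0.
Hypothesis sF : forall x, `|x| < d -> smooth_at x F.
Hypothesis lipF : forall x y, `|x| < d -> `|y| < d ->
  `|(x - F x) - (y - F y)| <= `|x - y| / 2.

Let d2 : d / 2 < d. Proof. by rewrite ltr_pdivrMr// ltr_pMr// ltr1n. Qed.

(** A solution of [F x = z] is a fixed point of [x |-> z + (x - F x)], which is a
    contraction of the closed ball of radius [d / 2] as soon as [z] is small. *)
Lemma local_inverse_ex z : `|z| < d / 4 -> exists x, `|x| <= d / 2 /\ F x = z.
Proof.
move=> zd; pose U : set 'rV[R]_n := [set x | `|x| <= d / 2].
pose T x := z + (x - F x).
have UT : set_fun U U T.
  move=> x /= xd; apply: le_trans (ler_normD _ _) _.
  have := lipF (le_lt_trans xd d2) (_ : `|0| < d); rewrite normr0 F0 !subr0 => /(_ d0) H.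
  rewrite (_ : d / 2 = d / 4 + d / 2 / 2); last by field.
  by apply: lerD; [exact: ltW|apply: le_trans H _; rewrite ler_pM2r// invr_gt0].
pose mT := isFun.Build _ _ U U T UT.
pose T' : {fun U >-> U} := HB.pack T mT.
have cT : is_contraction T'.
  exists ((2^-1 : R)%:nng); split=> /=; first by rewrite invf_lt1// ltr1n.
  move=> [x y] [/= xd yd]; rewrite /T opprD addrACA subrr add0r mulrC.
  by apply: lipF; exact: le_lt_trans d2.
have clU : closed U.
  rewrite (_ : U = (fun x : 'rV[R]_n => `|x|) @^-1` [set r : R | r <= d / 2])//.
  by apply: closed_comp (@closed_le R _) => x _; exact: norm_continuous.
have U0 : U !=set0 by exists 0; rewrite /U /= normr0 divr_ge0// ltW.
pose X : completeNormedModType R := HB.pack_for (completeNormedModType R) 'rV[R]_n.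
have [x Ux xT] := @banach_fixed_point R X U T' cT clU U0.
exists x; split=> //; move: xT; rewrite /= /T => /eqP.
by rewrite addrCA -subr_eq0 opprD addrA subrr sub0r oppr_eq0 subr_eq0 eq_sym => /eqP.
Qed.

Definition local_inverse z := xget 0 [set x | `|x| <= d / 2 /\ F x = z].
Notation H := local_inverse.

Lemma local_inverseP z : `|z| < d / 4 -> `|H z| < d /\ F (H z) = z.
Proof.
move=> /local_inverse_ex[x Px].
have [Hd FH] : [set x | `|x| <= d / 2 /\ F x = z] (H z).
  exact: xgetI Px.
by split=> //; exact: le_lt_trans d2.
Qed.

Lemma local_inverse_lipschitz z w : `|z| < d / 4 -> `|w| < d / 4 ->
  `|H z - H w| <= 2 * `|z - w|.
Proof.
move=> /local_inverseP[zd zF] /local_inverseP[wd wF].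
have := lipF zd wd; rewrite zF wF => L.
suff : `|H z - H w| <= `|H z - H w| / 2 + `|z - w| by lra.
apply: le_trans (lerD L (lexx _)).
rewrite (_ : H z - H w = H z - z - (H w - w) + (z - w)) ?ler_normD//.
by apply/rowP => i; rewrite !mxE; ring.
Qed.

Definition jac x : 'M[R]_n := \matrix_(i, j) ('D_(delta_mx 0 i) F x) 0 j.

Lemma derive_jac x v : `|x| < d -> 'D_v F x = v *m jac x.
Proof.
move=> xd; rewrite derive_sum_coord; last exact: smooth_at_differentiable (sF xd).
apply/rowP => j; rewrite summxE !mxE; apply: eq_bigr => i _.
by rewrite !mxE.
Qed.

(** If [v] is in the kernel of the derivative then [F (x + s v) - F x = o(s)], so [id - F]
    moves by about [s v], more than its Lipschitz constant [1/2] allows. *)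
Lemma jac_unit x : `|x| < d -> jac x \in unitmx.
Proof.
move=> xd; rewrite -row_free_unit; apply/row_freeP.
suff inj (v : 'rV[R]_n) : v *m jac x = 0 -> v = 0.
  exists (invmx (jac x)); apply: mulmxV; rewrite -row_free_unit -kermx_eq0.
  apply/eqP/row_matrixP => i; rewrite row0; apply: inj.
  by rewrite -row_mul mulmx_ker row0.
rewrite -derive_jac// => Dv.
have df := smooth_at_differentiable (sF xd).
apply/eqP; rewrite -normr_eq0; apply/negPn/negP => v0.
have vp : 0 < `|v| by rewrite lt_def v0 normr_ge0.
have e0 : (0 : R) < 1 / 4 by rewrite divr_gt0.
have [r r0 E] := near0_ball (differentiable_elim df e0).
(* Small enough for [x + s v] to stay in the ball and for the derivative to be
   accurate up to [1/4]. *)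
pose s := Num.min r (d - `|x|) / (2 * `|v|).
have m0 : 0 < Num.min r (d - `|x|) by rewrite lt_min r0 subr_gt0.
have s0 : 0 < s by rewrite divr_gt0// mulr_gt0.
have sv : `|s *: v| = Num.min r (d - `|x|) / 2.
  rewrite normrZ gtr0_norm// /s; field; exact: v0.
have sv1 : `|s *: v| < Num.min r (d - `|x|).
  by rewrite sv ltr_pdivrMr// ltr_pMr// ltr1n.
have [svr svd] : `|s *: v| < r /\ `|s *: v| < d - `|x|.
  by apply/andP; rewrite -lt_min.
have := E _ svr; rewrite derive_scalev// Dv scaler0 addr0 => E1.
have xs : `|s *: v + x| < d.
  by apply: le_lt_trans (ler_normD _ _) _; rewrite -ltrBrDr.
have := lipF xs xd.
rewrite addrK (_ : _ - _ = s *: v - (F (s *: v + x) - F x)); last first.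
  by apply/rowP => i; rewrite !mxE; ring.
move=> E2; have : `|s *: v| <= `|s *: v - (F (s *: v + x) - F x)| + `|F (s *: v + x) - F x|.
  by rewrite -{1}(subrK (F (s *: v + x) - F x) (s *: v)) ler_normD.
have svp : 0 < `|s *: v| by rewrite sv divr_gt0.
lra.
Qed.

(** With [h = H (z + y) - H z], the increment [y = F (H z + h) - F (H z)] is [h *m J] up to
    [o(h) = o(y)]; multiplying by the inverse of [J] gives the derivative of [H]. *)
Lemma local_inverse_differentiable z : `|z| < d / 4 ->
  differentiable H z /\ forall v, 'D_v H z = v *m invmx (jac (H z)).
Proof.
move=> zd; have [xd Fx] := local_inverseP zd.
set x := H z in xd Fx *; pose B := invmx (jac x).
apply: (@differentiable_intro _ _ H z (mulmxr B)); first exact: mulmxr_continuous.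
move=> e e0.
have [K K0 KB] := linear_lipschitz (@mulmxr_continuous n n B).
have e1 : 0 < e / (2 * K) by rewrite divr_gt0// mulr_gt0.
have df := smooth_at_differentiable (sF xd).
have [r r0 E] := near0_ball (differentiable_elim df e1).
pose c := Num.min (r / 2) (d / 4 - `|z|).
have c0 : 0 < c by rewrite lt_min divr_gt0//= subr_gt0.
have Nc : \forall y \near (0 : 'rV[R]_n), `|y| < c.
  by apply: (@cvgr_norm_lt _ _ _ (nbhs (0 : 'rV[R]_n)) _ id 0); rewrite ?normr0.
apply: filterS Nc => y; rewrite lt_min => /andP[yr yz].
have yzd : `|y + z| < d / 4.
  by apply: le_lt_trans (ler_normD _ _) _; rewrite -ltrBrDr.
have L := local_inverse_lipschitz yzd zd; rewrite addrK -/x in L.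
have [_ Fy] := local_inverseP yzd.
set h := H (y + z) - x in L.
have hr : `|h| < r by apply: le_lt_trans L _; rewrite mulrC -ltr_pdivlMr.
have := E _ hr; rewrite subrK Fy Fx derive_jac// => E1.
have -> : H (y + z) - (x + mulmxr B y) = mulmxr B (h *m jac x - y).
  rewrite /= mulmxBl -mulmxA mulmxV ?jac_unit// mulmx1 /h.
  by rewrite opprD addrA.
apply: le_trans (KB _) _.
rewrite distrC (_ : y - _ = y + z - (z + h *m jac x)); last first.
  by rewrite opprD addrA addrK.
apply: le_trans (ler_wpM2l (ltW K0) E1) _.
apply: le_trans (ler_wpM2l (ltW K0) (ler_wpM2l (ltW e1) L)) _.
rewrite le_eqVlt; apply/orP; left; apply/eqP; field.
by rewrite gt_eqF.
Qed.

(** The derivative of [H] is a smooth function of [H], so each order of smoothness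
    yields the next one. *)
Lemma local_inverse_smooth z : `|z| < d / 4 -> smooth_at z H.
Proof.
move=> zd; pose W : set 'rV[R]_n := [set x | `|x| < d].
pose V : set 'rV[R]_n := [set x | `|x| < d / 4].
have oN (c : R) : open [set x : 'rV[R]_n | `|x| < c].
  rewrite (_ : mkset _ = (fun x : 'rV[R]_n => `|x|) @^-1` [set r : R | r < c])//.
  by apply: open_comp (@open_lt R _) => x _; exact: norm_continuous.
exists V; split; [exact: oN|exact: zd|].
elim=> [|k IH].
  move=> x /local_inverse_differentiable[dH _]; exact: differentiable_continuous.
split=> [x /local_inverse_differentiable[]//|v].
have sg : smooth_on W (fun x => v *m invmx (jac x)).
  apply: smooth_at_on => x xd; apply: smooth_at_mulmx; first exact: smooth_at_cst.
  apply: smooth_at_invmx => [|i j]; first exact: jac_unit.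
  apply: (@smooth_at_ext _ _ _ _ (fun y => ('D_(delta_mx 0 i) F y) 0 j : R^o)).
    by move=> y; rewrite mxE.
  by apply: smooth_at_coord; apply: smooth_at_derive; exact: sF.
have HW x : V x -> W (H x) by move=> /local_inverseP[].
apply: Ck_eq (Ck_comp (oN _) HW IH (sg k)); first exact: oN.
by move=> x; rewrite inE => /local_inverse_differentiable[_ ->].
Qed.

End LocalInverse.

(** On an affine complement of the kernel of its derivative, [G] becomes a map tangent to
    the identity, and the local inverse of the latter gives the section. *)
Lemma local_section m n (G : 'rV[R]_m -> 'rV[R]_n) (x0 : 'rV[R]_m) :
  smooth_at x0 G -> (forall w, exists v, 'D_v G x0 = w) ->
  exists s : 'rV[R]_n -> 'rV[R]_m, [/\ smooth_at (G x0) s, s (G x0) = x0 &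
    \forall y \near G x0, G (s y) = y].
Proof.
move=> sG surj; have dG := smooth_at_differentiable sG.
have /choice[f fE] : forall i : 'I_n, exists v, 'D_v G x0 = delta_mx 0 i.
  by move=> i; exact: surj.
pose S : 'M[R]_(n, m) := \matrix_i f i.
have DS v : 'D_(v *m S) G x0 = v.
  rewrite deriveE// mulmx_sum_row linear_sum [RHS]row_sum_delta.
  by apply: eq_bigr => i _; rewrite linearZ -deriveE//= rowK fE.
pose aff (y : 'rV[R]_n) := x0 + y *m S.
have saff y : smooth_at y aff.
  apply: smooth_atD; first exact: smooth_at_cst.
  by apply: smooth_at_mulmx; [exact: smooth_at_id|move=> *; exact: smooth_at_cst].
have aff0 : aff 0 = x0 by rewrite /aff mul0mx addr0.
pose F y := G (aff y) - G x0.
have sF : smooth_at 0 F.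
  apply: smooth_atB; last exact: smooth_at_cst.
  by apply: smooth_at_comp; rewrite ?aff0.
have Daff v : 'D_v aff 0 = v *m S.
  rewrite /aff deriveD ?derive_cst ?add0r//.
    exact: (@derive_lin _ _ _ (mulmxr S) 0 v (@mulmxr_continuous _ _ S)).
  apply: diff_derivable; exact: linear_differentiable (@mulmxr_continuous _ _ S).
have dF v : 'D_v F 0 = v.
  have da := smooth_at_differentiable (saff 0).
  have dG0 : differentiable G (aff 0) by rewrite aff0.
  rewrite /F deriveB ?derive_cst ?subr0//; last first.
    by apply: diff_derivable; exact: (@differentiable_comp _ _ _ _ aff G).
  by rewrite (derive_chain v da dG0) Daff aff0 DS.
have [d d0 [sFd lip]] := near_id_lipschitz sF dF.
have F0 : F 0 = 0 by rewrite /F aff0 subrr.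
pose H := local_inverse F d.
have d4 : 0 < d / 4 by rewrite divr_gt0.
have H0 : H 0 = 0.
  have [|Hd FH] := @local_inverseP _ _ _ d0 F0 lip 0; first by rewrite normr0.
  have := lip _ 0 Hd; rewrite normr0 -/(H 0) FH F0 !subr0 => /(_ d0) L.
  by apply/eqP; rewrite -normr_le0; lra.
exists (fun y => aff (H (y - G x0))); split.
- apply: smooth_at_comp => //; apply: smooth_at_comp; last first.
    by apply: local_inverse_smooth => //; rewrite subrr normr0.
  by apply: smooth_atB; [exact: smooth_at_id|exact: smooth_at_cst].
- by rewrite subrr H0 aff0.
- have N : \forall y \near G x0, ball (G x0) (d / 4) y by exact: nbhsx_ballx.
  apply: filterS N => y; rewrite -ball_normE /= distrC => yd.
  have [_] := @local_inverseP _ _ _ d0 F0 lip _ yd.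
  by rewrite -/(H _) /F => /eqP; rewrite subr_eq subrK => /eqP.
Qed.

End InverseFunction.

(** * Smooth functions on manifolds *)

Section ManifoldGerms.
Context {R : realType}.

Section Charts.
Variables (n : nat) (T : topologicalType).
Implicit Types (c d : chart R n T) (p : T).

Lemma near_cdom c p : cdom c p -> \forall q \near p, cdom c q.
Proof. by move=> cp; exact: open_nbhs_nbhs (conj (cdom_open c) cp). Qed.

Lemma near_cinv c p (P : T -> Prop) : cdom c p -> (\forall q \near p, P q) ->
  \forall x \near cmap c p, P (cinv c x).
Proof. by move=> cp nP; apply: (cinv_continuous cp); rewrite cmapK. Qed.

Lemma near_cmap c p (P : 'rV[R]_n -> Prop) : cdom c p ->
  (\forall x \near cmap c p, P x) -> \forall q \near p, P (cmap c q).
Proof. by move=> cp nP; exact: cmap_continuous cp _ nP. Qed.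

Lemma near_cimg c p : cdom c p ->
  \forall x \near cmap c p, exists2 q, cdom c q & cmap c q = x.
Proof. by move=> cp; apply: open_nbhs_nbhs; split; [exact: cimg_open|exists p]. Qed.

Lemma transition_smooth c d p : compatible c d -> cdom c p -> cdom d p ->
  smooth_at (cmap c p) (cmap d \o cinv c).
Proof.
move=> cd cp dp; apply: smooth_on_at cd; last by exists p.
by rewrite setIC; apply: chart_img_open; exact: cdom_open.
Qed.

Lemma change_chart (V : normedModType R) (f : T -> V) c d p :
  compatible c d -> cdom c p -> cdom d p ->
  smooth_at (cmap d p) (f \o cinv d) -> smooth_at (cmap c p) (f \o cinv c).
Proof.
move=> cd cp dp sf.
have st := transition_smooth cd cp dp.
have := @smooth_at_comp _ _ _ _ _ (cmap d \o cinv c) (f \o cinv d) st.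
rewrite {1}/comp cmapK// => /(_ sf); apply: smooth_at_eq.
by apply: filterS (near_cinv cp (near_cdom dp)) => x dx; rewrite /= cmapK.
Qed.
End Charts.

Section Functions.
Variables (n : nat) (M : manifold R n).
Implicit Types (p : M) (c : chart R n M).

Definition msmooth_at (V : normedModType R) p (f : M -> V) :=
  smooth_at (cmap (chart_at p) p) (f \o cinv (chart_at p)).

Lemma msmooth_at_chart (V : normedModType R) c p (f : M -> V) :
  atlas c -> cdom c p -> msmooth_at p f <-> smooth_at (cmap c p) (f \o cinv c).
Proof.
move=> ac cp; have dp := cdom_at p; have ad := atlas_at p.
by split; apply: change_chart => //; exact: atlas_compatible.
Qed.

Lemma msmoothP (V : normedModType R) (W : set M) (f : M -> V) : open W ->
  msmooth W f <-> forall p, W p -> msmooth_at p f.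
Proof.
move=> oW; split=> [sf p Wp|sf c ac].
  apply: smooth_on_at (sf _ (atlas_at p)); first exact: chart_img_open.
  by exists p => //; split=> //; exact: cdom_at.
apply: smooth_at_on => _ [q [Wq cq] <-].
exact: (msmooth_at_chart f ac cq).1 (sf _ Wq).
Qed.

Lemma msmooth_at_near (V : normedModType R) p (f : M -> V) :
  msmooth_at p f -> \forall q \near p, msmooth_at q f.
Proof.
move=> /smooth_at_near/(near_cmap (cdom_at p)) N.
apply: filterS2 N (near_cdom (cdom_at p)) => q sq cq.
exact: (msmooth_at_chart f (atlas_at p) cq).2.
Qed.

Lemma msmooth_at_eq (V : normedModType R) p (f g : M -> V) :
  (\forall q \near p, f q = g q) -> msmooth_at p f -> msmooth_at p g.
Proof. by move=> /(near_cinv (cdom_at p)); exact: smooth_at_eq. Qed.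

Lemma msmooth_at_cst (V : normedModType R) p (a : V) : msmooth_at p (fun=> a).
Proof. exact: smooth_at_cst. Qed.

Lemma msmooth_atD (V : normedModType R) p (f g : M -> V) :
  msmooth_at p f -> msmooth_at p g -> msmooth_at p (fun q => f q + g q).
Proof. exact: smooth_atD. Qed.

Lemma msmooth_atZ (V : normedModType R) p (a : M -> R^o) (f : M -> V) :
  msmooth_at p a -> msmooth_at p f -> msmooth_at p (fun q => (a q : R) *: f q).
Proof. exact: smooth_atZ. Qed.

Lemma msmooth_atM p (f g : M -> R^o) :
  msmooth_at p f -> msmooth_at p g -> msmooth_at p (fun q => (f q * g q : R) : R^o).
Proof. exact: smooth_atM. Qed.

Lemma msmooth_at_sum (V : normedModType R) p (I : Type) (s : seq I) (P : pred I)
    (f : I -> M -> V) : (forall i, P i -> msmooth_at p (f i)) ->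
  msmooth_at p (fun q => \sum_(i <- s | P i) f i q).
Proof. exact: smooth_at_sum. Qed.

Lemma msmooth_at_coord m p (f : M -> 'rV[R]_m) j :
  msmooth_at p f -> msmooth_at p (fun q => f q 0 j : R^o).
Proof. exact: smooth_at_coord. Qed.

Lemma msmooth_at_row m p (f : M -> 'rV[R]_m) :
  (forall j, msmooth_at p (fun q => f q 0 j : R^o)) -> msmooth_at p f.
Proof. exact: smooth_at_row. Qed.

(** The part of a chart that lies over a closed ball is compact, hence closed in the
    Hausdorff space [M]: this makes the extension of a bump function by zero smooth. *)
Lemma bump_manifold p (W : set M) : open W -> W p ->
  exists b : M -> R^o, exists C : set M, [/\ closed C, C `<=` W,
    forall q, msmooth_at q b, \forall q \near p, b q = 1 &
    forall q, ~ C q -> b q = 0].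
Proof.
move=> oW Wp; pose c := chart_at p; have cp : cdom c p := cdom_at p.
have ac : atlas c := atlas_at p.
have /nbhs_ballP[e /= e0 eW] : nbhs (cmap c p) (cmap c @` (W `&` cdom c)).
  by apply: open_nbhs_nbhs; split; [exact: chart_img_open|exists p].
pose K : set 'rV[R]_n := [set x | `|x - cmap c p| <= e / 2].
have e2 : 0 < e / 2 by rewrite divr_gt0.
have KW : K `<=` cmap c @` (W `&` cdom c).
  move=> x Kx; apply: eW; rewrite -ball_normE /= distrC; apply: le_lt_trans Kx _.
  by rewrite ltr_pdivrMr// ltr_pMr// ltr1n.
have cK : compact K.
  apply: bounded_closed_compact.
    exists (e / 2 + `|cmap c p|); split; first exact: num_real.
    move=> r hr x /= Kx; apply: ltW; apply: le_lt_trans hr.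
    by rewrite -[x in leLHS](subrK (cmap c p)); apply: le_trans (ler_normD _ _) _; rewrite lerD2r.
  rewrite (_ : K = (fun x : 'rV[R]_n => `|x - cmap c p|) @^-1` [set r : R | r <= e / 2])//.
  apply: closed_comp (@closed_le R _) => x _; apply: continuous_comp; last exact: norm_continuous.
  by apply: continuousB; [exact: cvg_id|exact: cst_continuous].
have [b [sb b1 b0]] := bump_rV (cmap c p) e2.
pose C : set M := cinv c @` K.
have CW : C `<=` W `&` cdom c by move=> _ [x /KW[q Wq <-] <-]; rewrite cmapK//; case: Wq.
have clC : closed C.
  apply: compact_closed; first exact: m_hausdorff.
  apply: continuous_compact cK; apply: continuous_in_subspaceT => x.
  by rewrite inE => /KW[q [_ cq] <-]; exact: cinv_continuous.
pose b' (q : M) : R^o := if pselect (cdom c q) then b (cmap c q) else 0.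
have b'0 q : ~ C q -> b' q = 0.
  rewrite /b' => nC; case: pselect => // cq; apply: b0 => Bq; apply: nC.
  exists (cmap c q); last by rewrite cmapK.
  by move: Bq; rewrite -ball_normE /= distrC => /ltW.
exists b', C; split=> //; first by move=> q /CW[].
- move=> q; have [Cq|nC] := pselect (C q); last first.
    apply: (@msmooth_at_eq _ _ (fun=> 0)); last exact: msmooth_at_cst.
    have : open (~` C) by exact: closed_openC.
    move=> oC; apply: filterS (open_nbhs_nbhs (conj oC nC)) => y /b'0 ->//.
  have [_ cq] := CW _ Cq.
  apply: (msmooth_at_chart b' ac cq).2; apply: smooth_at_eq (sb (cmap c q)).
  apply: filterS (near_cimg cq) => _ [y cy <-] /=.
  by rewrite cmapK// /b'; case: pselect.
- have := near_cmap cp b1; apply: filterS2 (near_cdom cp) => q cq bq.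
  by rewrite /b'; case: pselect.
Qed.

End Functions.
End ManifoldGerms.

(** * Sections, bundle maps and connections *)

Lemma near_open (T : topologicalType) (p : T) (P : T -> Prop) :
  (\forall q \near p, P q) -> exists W : set T, [/\ open W, W p & forall q, W q -> P q].
Proof. by rewrite /prop_near1 nbhsE => -[W [oW Wp] PW]; exists W. Qed.

Section Sections.
Context {R : realType}.
Variables (n : nat) (M : manifold R n) (r : nat) (E : vbundle M r).
Implicit Types (p : M) (s t : section E).

(** It is enough to test one trivialisation around [p], by [ssmooth_at_triv]; asking for
    all of them makes the notion convenient to use. *)
Definition ssmooth_at p s :=
  forall i, tdom i p -> msmooth_at p (fun q => triv i q (s q)).

Definition frame (i : tidx E) (k : 'I_r) : section E :=
  fun q => trivV i q (delta_mx 0 k).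

Lemma near_tdom (i : tidx E) p : tdom i p -> \forall q \near p, tdom i q.
Proof. by move=> ip; exact: open_nbhs_nbhs (conj (tdom_open i) ip). Qed.

Lemma trivV_sum (i : tidx E) p (u : 'rV[R]_r) :
  trivV i p u = \sum_k u 0 k *: frame i k p.
Proof.
rewrite {1}[u]row_sum_delta linear_sum; apply: eq_bigr => k _.
by rewrite linearZ.
Qed.

Lemma frame_sum (i : tidx E) p (e : E p) : tdom i p ->
  e = \sum_k triv i p e 0 k *: frame i k p.
Proof. by move=> ip; rewrite -trivV_sum trivK. Qed.

Lemma triv_frame (i : tidx E) p k : tdom i p -> triv i p (frame i k p) = delta_mx 0 k.
Proof. by move=> ip; rewrite /frame trivVK. Qed.

Lemma ssmooth_at_triv i p s : tdom i p ->
  msmooth_at p (fun q => triv i q (s q)) -> ssmooth_at p s.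
Proof.
move=> ip si j jp.
apply: (@msmooth_at_eq _ _ _ _ _ (fun q =>
    \sum_k triv i q (s q) 0 k *: triv j q (trivV i q (delta_mx 0 k)))).
  apply: filterS (near_tdom ip) => q iq.
  rewrite [in RHS](frame_sum (s q) iq) linear_sum.
  by apply: eq_bigr => k _; rewrite linearZ.
apply: msmooth_at_sum => k _; apply: msmooth_atZ; first exact: msmooth_at_coord.
have oI : open (tdom i `&` tdom j) by apply: openI; exact: tdom_open.
exact: (msmoothP _ oI).1 (triv_smooth i j (delta_mx 0 k)) _ (conj ip jp).
Qed.

Lemma smooth_section_onP (W : set M) s : open W ->
  smooth_section_on W s <-> forall p, W p -> ssmooth_at p s.
Proof.
move=> oW; have oI i : open (W `&` @tdom _ _ _ _ E i) by apply: openI => //; exact: tdom_open.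
split=> [ss p Wp i ip|ss i]; first exact: (msmoothP _ (oI i)).1 (ss i) _ (conj Wp ip).
by apply/(msmoothP _ (oI i)) => p [Wp ip]; exact: ss.
Qed.

Lemma smooth_sectionP s : smooth_section s <-> forall p, ssmooth_at p s.
Proof.
split=> [/(smooth_section_onP _ openT) ss p|ss]; first exact: ss.
by apply/(smooth_section_onP _ openT) => p _.
Qed.

Lemma ssmooth_at_near p s : ssmooth_at p s -> \forall q \near p, ssmooth_at q s.
Proof.
move=> /(_ _ (tdom_at E p))/msmooth_at_near sn.
by apply: filterS2 sn (near_tdom (tdom_at E p)) => q sq iq; exact: ssmooth_at_triv sq.
Qed.

Lemma smooth_nearP p s : smooth_near p s <-> ssmooth_at p s.
Proof.
split=> [[W [oW Wp /(smooth_section_onP _ oW)]]|]; first exact.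
move=> /ssmooth_at_near/near_open[W [oW Wp sW]].
by exists W; split=> //; apply/smooth_section_onP.
Qed.

Lemma ssmooth_at_eq p s t : (\forall q \near p, s q = t q) ->
  ssmooth_at p s -> ssmooth_at p t.
Proof.
move=> st ss i ip; apply: msmooth_at_eq (ss i ip).
by apply: filterS st => q ->.
Qed.

Lemma ssmooth_atD p s t : ssmooth_at p s -> ssmooth_at p t ->
  ssmooth_at p (fun q => s q + t q).
Proof.
move=> ss st i ip; apply: msmooth_at_eq (msmooth_atD (ss i ip) (st i ip)).
by apply: filterE => q; rewrite linearD.
Qed.

Lemma ssmooth_atZ p (a : M -> R^o) s : msmooth_at p a -> ssmooth_at p s ->
  ssmooth_at p (fun q => (a q : R) *: s q).
Proof.
move=> sa ss i ip; apply: msmooth_at_eq (msmooth_atZ sa (ss i ip)).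
by apply: filterE => q; rewrite linearZ.
Qed.

Lemma ssmooth_at0 p s : (\forall q \near p, s q = 0) -> ssmooth_at p s.
Proof.
move=> s0 i ip; apply: (@msmooth_at_eq _ _ _ _ _ (fun=> 0)); last exact: msmooth_at_cst.
by apply: filterS s0 => q ->; rewrite linear0.
Qed.

Lemma ssmooth_at_sum p (I : Type) (l : seq I) (s : I -> section E) :
  (forall i, ssmooth_at p (s i)) -> ssmooth_at p (fun q => \sum_(i <- l) s i q).
Proof.
move=> ss; elim: l => [|i l IH].
  by apply: ssmooth_at0; apply: filterE => q; rewrite big_nil.
by apply: ssmooth_at_eq (ssmooth_atD (ss i) IH); apply: filterE => q; rewrite big_cons.
Qed.

Lemma ssmooth_at_trivV (i : tidx E) p (u : 'rV[R]_r) : tdom i p ->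
  ssmooth_at p (fun q => trivV i q u).
Proof.
move=> ip; apply: (@ssmooth_at_triv i) => //.
apply: (@msmooth_at_eq _ _ _ _ _ (fun=> u)); last exact: msmooth_at_cst.
by apply: filterS (near_tdom ip) => q iq; rewrite trivVK.
Qed.

Lemma msmooth_at_component (i : tidx E) p s k : tdom i p -> ssmooth_at p s ->
  msmooth_at p (fun q => triv i q (s q) 0 k : R^o).
Proof. by move=> ip ss; apply: msmooth_at_coord; exact: ss. Qed.

(** Multiplying a germ by a bump function makes it global. This is how statements about
    global sections are applied to local frames and to single vectors. *)
Lemma extend_section p s : ssmooth_at p s ->
  exists2 t, smooth_section t & \forall q \near p, t q = s q.
Proof.
move=> /ssmooth_at_near/near_open[W [oW Wp sW]].
have [b [C [clC CW sb b1 b0]]] := bump_manifold oW Wp.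
exists (fun q => b q *: s q).
  apply/smooth_sectionP => q; have [Cq|nC] := pselect (C q).
    by apply: ssmooth_atZ => //; exact/sW/CW.
  apply: ssmooth_at0.
  have oC : open (~` C) by exact: closed_openC.
  by apply: filterS (open_nbhs_nbhs (conj oC nC)) => y /b0 ->; rewrite scale0r.
by apply: filterS b1 => q ->; rewrite scale1r.
Qed.

Lemma extend_vector p (e : E p) : exists2 t, smooth_section t & t p = e.
Proof.
have ip := tdom_at E p.
have [t st te] := extend_section (ssmooth_at_trivV (triv (triv_at E p) p e) ip).
by exists t => //; rewrite (nbhs_singleton te) trivK.
Qed.

End Sections.

Section BundleMaps.
Context {R : realType}.
Variables (n : nat) (M : manifold R n) (r1 r2 : nat).
Variables (E : vbundle M r1) (F : vbundle M r2).

Lemma ssmooth_at_bmap (b : bmap E F) p (s : section E) :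
  ssmooth_at p s -> ssmooth_at p (fun q => b q (s q) : F q).
Proof.
move=> ss; have ip := tdom_at E p; set i := triv_at E p in ip.
apply: (@ssmooth_at_eq _ _ _ _ _ _ (fun q =>
    \sum_k (triv i q (s q) 0 k : R^o) *: b q (frame i k q))).
  apply: filterS (near_tdom ip) => q iq.
  by rewrite [in RHS](frame_sum (s q) iq) linear_sum; apply: eq_bigr => k _; rewrite linearZ.
apply: ssmooth_at_sum => k; apply: ssmooth_atZ; first exact: msmooth_at_component.
by have /(smooth_section_onP _ (tdom_open i)) := bmap_smooth b i (delta_mx 0 k); exact.
Qed.

Lemma smooth_section_bmap (b : bmap E F) (s : section E) :
  smooth_section s -> smooth_section (fun q => b q (s q) : F q).
Proof.
by move=> /smooth_sectionP ss; apply/smooth_sectionP => p; exact: ssmooth_at_bmap.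
Qed.

End BundleMaps.

Section DirectionalDerivative.
Context {R : realType}.
Variables (n : nat) (M : manifold R n).
Implicit Types (p : M) (f g : M -> R).

Lemma dirder_eq p (v : TM M p) f g : (\forall q \near p, f q = g q) -> dirder v f = dirder v g.
Proof.
move=> fg; apply: near_eq_derive.
exact: (near_cinv (P := fun q => f q = g q) (cdom_at p) fg).
Qed.

Lemma dirder_cst p (v : TM M p) (a : R) : dirder v (fun=> a) = 0.
Proof. exact: derive_cst. Qed.

Lemma dirderD p (v : TM M p) (f g : M -> R^o) : msmooth_at p f -> msmooth_at p g ->
  dirder v (fun q => f q + g q) = dirder v f + dirder v g.
Proof.
move=> /smooth_at_differentiable df /smooth_at_differentiable dg.
by apply: (@deriveD R _ R^o); exact: diff_derivable.
Qed.

Lemma dirderM p (v : TM M p) (f g : M -> R^o) : msmooth_at p f -> msmooth_at p g ->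
  dirder v (fun q => f q * g q) = f p * dirder v g + dirder v f * g p.
Proof.
move=> /smooth_at_differentiable df /smooth_at_differentiable dg.
have [_ E] := derive_scale df dg.
by rewrite /dirder; apply: etrans (E _) _; rewrite /= cmapK//; exact: cdom_at.
Qed.

Lemma dirder_sum p (v : TM M p) (I : Type) (l : seq I) (f : I -> M -> R^o) :
  (forall i, msmooth_at p (f i)) ->
  dirder v (fun q => \sum_(i <- l) f i q) = \sum_(i <- l) dirder v (f i).
Proof.
move=> sf; elim: l => [|i l IH].
  by rewrite big_nil (_ : (fun q => _) = fun=> 0) ?dirder_cst//;
    apply/funext => q; rewrite big_nil.
rewrite big_cons -IH -dirderD//; last exact: msmooth_at_sum.
by congr dirder; apply/funext => q; rewrite big_cons.
Qed.

End DirectionalDerivative.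

Section Connections.
Context {R : realType}.
Variables (n : nat) (M : manifold R n) (r : nat) (E : vbundle M r).
Variables (D : covder E) (hD : is_connection D).
Arguments D : clear implicits.
Implicit Types (p : M) (s t : section E).

Lemma connD p v s t : ssmooth_at p s -> ssmooth_at p t ->
  D p v (fun q => s q + t q) = D p v s + D p v t.
Proof. by move=> /smooth_nearP ss /smooth_nearP st; exact: conn_add. Qed.

Lemma connZ p v (g : M -> R^o) s : msmooth_at p g -> ssmooth_at p s ->
  D p v (fun q => (g q : R) *: s q) = dirder v g *: s p + (g p : R) *: D p v s.
Proof.
move=> /msmooth_at_near sg /smooth_nearP ss; apply: (conn_leibniz hD) => //.
have [W [oW Wp sW]] := near_open sg; exists W; split=> //.
exact/msmoothP.
Qed.

(** Multiplying by the indicator function of a neighbourhood, which is locally constant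
    there, shows that a connection only depends on germs. *)
Lemma conn_local p v s t : ssmooth_at p s -> (\forall q \near p, s q = t q) ->
  D p v s = D p v t.
Proof.
move=> ss st; have st' := ssmooth_at_eq st ss.
have [W [oW Wp sW]] := near_open st.
pose g (q : M) : R^o := if pselect (W q) then 1 else 0.
have gp : g p = 1 by rewrite /g; case: pselect.
have g1 : \forall q \near p, 1 = g q.
  by apply: filterS (open_nbhs_nbhs (conj oW Wp)) => q Wq; rewrite /g; case: pselect.
have sg : msmooth_at p g by apply: msmooth_at_eq g1 _; exact: msmooth_at_cst.
have Dg u : ssmooth_at p u -> D p v (fun q => (g q : R) *: u q) = D p v u.
  move=> su; rewrite connZ// gp scale1r (_ : dirder v g = 0) ?scale0r ?add0r//.
  by rewrite -(dirder_eq v g1) dirder_cst.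
rewrite -Dg// -[RHS]Dg//; congr (D p v _); apply: functional_extensionality_dep => q.
have [/sW ->//|nWq] := pselect (W q).
by rewrite (_ : g q = 0) ?scale0r// /g; case: pselect.
Qed.

Lemma conn_vec0 p s : ssmooth_at p s -> D p 0 s = 0.
Proof.
move=> /smooth_nearP ss; have := conn_linear hD ss 1 0 0.
rewrite scaler0 addr0 scale1r => /eqP; rewrite -subr_eq subrr eq_sym.
by move=> /eqP.
Qed.

Lemma conn_vec_sum p (I : Type) (l : seq I) (a : I -> R) (w : I -> TM M p) s :
  ssmooth_at p s ->
  D p (\sum_(i <- l) a i *: w i) s = \sum_(i <- l) a i *: D p (w i) s.
Proof.
move=> ss; elim: l => [|i l IH]; first by rewrite !big_nil conn_vec0.
rewrite !big_cons -IH; move: ss => /smooth_nearP ss.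
exact: (conn_linear hD ss).
Qed.

Lemma conn0 p v : D p v (fun=> 0) = 0.
Proof.
have s0 : ssmooth_at p ((fun=> 0) : section E) by apply: ssmooth_at0; exact: filterE.
have := connZ v (msmooth_at_cst p (0 : R^o)) s0.
rewrite dirder_cst !scale0r addr0 => D0; rewrite -[RHS]D0; congr (D p v _).
by apply: functional_extensionality_dep => q; rewrite scaler0.
Qed.

Lemma conn_sum p v (I : Type) (l : seq I) (g : I -> M -> R^o) (s : I -> section E) :
  (forall i, msmooth_at p (g i)) -> (forall i, ssmooth_at p (s i)) ->
  D p v (fun q => \sum_(i <- l) (g i q : R) *: s i q) =
  \sum_(i <- l) (dirder v (g i) *: s i p + (g i p : R) *: D p v (s i)).
Proof.
move=> sg ss; elim: l => [|i l IH].
  rewrite big_nil -[RHS](conn0 v); congr (D p v _).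
  by apply: functional_extensionality_dep => q; rewrite big_nil.
rewrite big_cons -IH -connZ// -connD; last 2 first.
- exact: ssmooth_atZ.
- by apply: ssmooth_at_sum => j; exact: ssmooth_atZ.
by congr (D p v _); apply: functional_extensionality_dep => q; rewrite big_cons.
Qed.

Lemma connN p v s : ssmooth_at p s -> D p v (fun q => - s q) = - D p v s.
Proof.
move=> ss; have := connZ v (msmooth_at_cst p (-1 : R^o)) ss.
rewrite dirder_cst scale0r add0r scaleN1r => <-; congr (D p v _).
by apply: functional_extensionality_dep => q; rewrite scaleN1r.
Qed.

Lemma connB p v s t : ssmooth_at p s -> ssmooth_at p t ->
  D p v (fun q => s q - t q) = D p v s - D p v t.
Proof.
move=> ss st; rewrite connD ?connN//.
apply: ssmooth_at_eq (ssmooth_atZ (msmooth_at_cst p (-1 : R^o)) st).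
by apply: filterE => q; rewrite scaleN1r.
Qed.

Lemma ssmooth_at_conn (X : section (TM M)) s : smooth_section X -> smooth_section s ->
  smooth_section (fun q => D q (X q) s).
Proof. by move=> sX ss; apply: (conn_smooth hD) => //; exact: openT. Qed.

End Connections.

(** * Differentials and Lie brackets *)

Section EuclideanBrackets.
Context {R : realType}.

Lemma derive_bigsum n (V : normedModType R) (I : Type) (l : seq I)
    (f : I -> 'rV[R]_n -> V) x v : (forall i, smooth_at x (f i)) ->
  'D_v (fun y => \sum_(i <- l) f i y) x = \sum_(i <- l) 'D_v (f i) x.
Proof.
move=> sf; elim: l => [|i l IH].
  rewrite big_nil (_ : (fun y => _) = cst 0) ?derive_cst//.
  by apply/funext => y; rewrite big_nil.
rewrite big_cons -IH -deriveD; last 2 first.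
- exact: diff_derivable (smooth_at_differentiable (sf i)).
- by apply: diff_derivable; apply: smooth_at_differentiable; exact: smooth_at_sum.
by congr ('D_v _ x); apply/funext => y; rewrite big_cons.
Qed.

Lemma derive_subv (V W : normedModType R) (f : V -> W) x u v :
  differentiable f x -> 'D_(u - v) f x = 'D_u f x - 'D_v f x.
Proof. by move=> df; rewrite !deriveE// linearB. Qed.

Lemma derive_along m n (phi : 'rV[R]_m -> 'rV[R]_n) (Y : 'rV[R]_m -> 'rV[R]_m) x v :
  smooth_at x phi -> smooth_at x Y ->
  'D_v (fun y => 'D_(Y y) phi y) x = 'D_('D_v Y x) phi x + 'D_(Y x) ('D_v phi) x.
Proof.
move=> sphi sY.
have swap (a b : R) (p q s : 'rV[R]_n) : p = s -> a *: p + b *: q = b *: q + a *: s.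
  by move=> ->; rewrite addrC.
have sYj j : smooth_at x (fun y => Y y 0 j : R^o) by exact: smooth_at_coord.
have sD j : smooth_at x ('D_(delta_mx 0 j) phi) by exact: smooth_at_derive.
transitivity ('D_v (fun y => \sum_j (Y y 0 j : R^o) *: 'D_(delta_mx 0 j) phi y) x).
  apply: near_eq_derive; apply: filterS (smooth_at_near sphi) => y /smooth_at_differentiable.
  exact: derive_sum_coord.
rewrite derive_bigsum; last by move=> j; exact: smooth_atZ.
have dY := smooth_at_differentiable sY.
rewrite derive_sum_coord; last exact: smooth_at_differentiable sphi.
rewrite [X in _ = _ + X]derive_sum_coord; last first.
  exact: smooth_at_differentiable (smooth_at_derive v sphi).
rewrite -big_split; apply: eq_bigr => j _ /=.
have [_ ->] := derive_scale (smooth_at_differentiable (sYj j))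
  (smooth_at_differentiable (sD j)).
have [_ ->] := derive_coord v j dY.
exact: swap (schwarz (delta_mx 0 j) v sphi).
Qed.

(** The second derivatives of [phi] that arise on the right cancel by symmetry. *)
Lemma derive_bracket m n (phi : 'rV[R]_m -> 'rV[R]_n) (X Y : 'rV[R]_m -> 'rV[R]_m) x :
  smooth_at x phi -> smooth_at x X -> smooth_at x Y ->
  'D_('D_(X x) Y x - 'D_(Y x) X x) phi x =
  'D_(X x) (fun y => 'D_(Y y) phi y) x - 'D_(Y x) (fun y => 'D_(X y) phi y) x.
Proof.
move=> sphi sX sY; have dphi := smooth_at_differentiable sphi.
have sub (V : zmodType) (p q s s' A B : V) : A = p + s -> B = q + s' -> s' = s ->
    p - q = A - B.
  by move=> -> -> ->; rewrite opprD addrACA subrr addr0.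
apply: etrans (derive_subv _ _ dphi) _.
exact: sub (derive_along (X x) sphi sY) (derive_along (Y x) sphi sX)
  (esym (schwarz (X x) (Y x) sphi)).
Qed.

End EuclideanBrackets.

Section SmoothMaps.
Context {R : realType}.
Variables (m n : nat) (N : manifold R m) (M : manifold R n).
Variables (f : N -> M) (sf : smooth_map f).
Implicit Types p : N.

Lemma near_pullback p (P : M -> Prop) : (\forall y \near f p, P y) -> \forall q \near p, P (f q).
Proof. by move: sf => [cf _] nP; exact: cf _ nP. Qed.

Lemma smooth_map_at p (c : chart R m N) (d : chart R n M) :
  atlas c -> atlas d -> cdom c p -> cdom d (f p) ->
  smooth_at (cmap c p) (cmap d \o f \o cinv c).
Proof.
move: sf => [cf Cf] ac ad cp dp; apply: smooth_on_at (Cf c d ac ad).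
  rewrite setIC; apply: chart_img_open.
  by apply: open_comp (cdom_open d) => x _; exact: cf.
by exists p.
Qed.

Lemma msmooth_at_comp (V : normedModType R) p (g : M -> V) :
  msmooth_at (f p) g -> msmooth_at p (g \o f).
Proof.
move=> sg; have dp := cdom_at (f p).
have s1 := smooth_map_at (atlas_at p) (atlas_at (f p)) (cdom_at p) dp.
have := @smooth_at_comp _ _ _ _ _ _ (g \o cinv (chart_at (f p))) s1.
rewrite {1}/comp /= cmapK; last exact: cdom_at.
move=> /(_ sg); apply: smooth_at_eq.
apply: filterS (near_cinv (cdom_at p) (near_pullback (near_cdom dp))) => x dx.
by rewrite /= cmapK.
Qed.

Lemma derive_change_chart (V : normedModType R) (G : N -> V) (c d : chart R m N) p w :
  compatible c d -> cdom c p -> cdom d p ->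
  smooth_at (cmap d p) (G \o cinv d) ->
  'D_('D_w (cmap d \o cinv c) (cmap c p)) (G \o cinv d) (cmap d p) =
  'D_w (G \o cinv c) (cmap c p).
Proof.
move=> cd cp dp sG.
have pE : (cmap d \o cinv c) (cmap c p) = cmap d p by rewrite /= cmapK.
have d1 := smooth_at_differentiable (transition_smooth cd cp dp).
have d2 : differentiable (G \o cinv d) ((cmap d \o cinv c) (cmap c p)).
  by rewrite pE; exact: smooth_at_differentiable.
rewrite -{1}pE -(derive_chain w d1 d2); apply: near_eq_derive.
by apply: filterS (near_cinv cp (near_cdom dp)) => x dx; rewrite /= cmapK.
Qed.

Lemma mdiff_chart p (c : chart R m N) (d : chart R n M) (v : TM N p) :
  atlas c -> atlas d -> cdom c p -> cdom d (f p) ->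
  chart_diff (chart_at (f p)) d (f p) (mdiff f v) =
  'D_(chart_diff (chart_at p) c p v) (cmap d \o f \o cinv c) (cmap c p).
Proof.
move=> ac ad cp dp.
have [c0p d0p] := (cdom_at p, cdom_at (f p)).
rewrite (chart_diffE _ (atlas_at _) ad d0p dp).
apply: etrans; last first.
  apply: esym; apply: (etrans (congr1 (fun u => 'D_u _ _)
    (chart_diffE v (atlas_at p) ac c0p cp))).
  apply: (@derive_change_chart _ (cmap d \o f)) => //.
    by apply: atlas_compatible => //; exact: atlas_at.
  exact: smooth_map_at.
have s1 := smooth_map_at (atlas_at p) (atlas_at (f p)) c0p d0p.
have pE : (cmap (chart_at (f p)) \o f \o cinv (chart_at p)) (cmap (chart_at p) p) =
  cmap (chart_at (f p)) (f p) by rewrite /= cmapK.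
have d2 : differentiable (cmap d \o cinv (chart_at (f p)))
  ((cmap (chart_at (f p)) \o f \o cinv (chart_at p)) (cmap (chart_at p) p)).
  by rewrite pE; apply: compatible_differentiable => //; exact: atlas_at.
rewrite -{1}pE -(derive_chain v (smooth_at_differentiable s1) d2).
apply: near_eq_derive.
apply: filterS (near_cinv c0p (near_pullback (near_cdom d0p))) => x dx.
by rewrite /= cmapK.
Qed.

Lemma mdiff_is_linear p (a : R) (u v : TM N p) :
  mdiff f (a *: u + v : TM N p) = a *: mdiff f u + mdiff f v.
Proof.
have := smooth_map_at (atlas_at p) (atlas_at (f p)) (cdom_at p) (cdom_at (f p)).
move=> /smooth_at_differentiable df.
by rewrite /mdiff derive_addv// derive_scalev.
Qed.

Lemma dirder_comp p (v : TM N p) (g : M -> R^o) : msmooth_at (f p) g ->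
  dirder (mdiff f v) g = dirder v (g \o f).
Proof.
move=> sg; have [c0p d0p] := (cdom_at p, cdom_at (f p)).
have s1 := smooth_map_at (atlas_at p) (atlas_at (f p)) c0p d0p.
have pE : (cmap (chart_at (f p)) \o f \o cinv (chart_at p)) (cmap (chart_at p) p) =
  cmap (chart_at (f p)) (f p) by rewrite /= cmapK.
have d2 : differentiable (g \o cinv (chart_at (f p)))
  ((cmap (chart_at (f p)) \o f \o cinv (chart_at p)) (cmap (chart_at p) p)).
  by rewrite pE; exact: smooth_at_differentiable.
rewrite /dirder -{1}pE -(derive_chain v (smooth_at_differentiable s1) d2).
apply: near_eq_derive.
apply: filterS (near_cinv c0p (near_pullback (near_cdom d0p))) => x dx.
by rewrite /= cmapK.
Qed.

End SmoothMaps.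

Section VectorFields.
Context {R : realType}.

Lemma vf_coordE n (M : manifold R n) (c : chart R n M) (X : section (TM M)) q :
  cdom c q -> vf_coord c X (cmap c q) = chart_diff (chart_at q) c q (X q).
Proof. by move=> cq; rewrite /vf_coord cmapK. Qed.

Lemma vf_coord_at n (M : manifold R n) (X : section (TM M)) q :
  vf_coord (chart_at q) X (cmap (chart_at q) q) = X q.
Proof.
rewrite vf_coordE; last exact: cdom_at.
by apply: chart_diff_id; [exact: atlas_at|exact: cdom_at].
Qed.

Lemma vf_coord_smooth n (M : manifold R n) (c : chart R n M) (X : section (TM M)) q :
  atlas c -> cdom c q -> ssmooth_at q X -> smooth_at (cmap c q) (vf_coord c X).
Proof.
move=> ac cq sX; have := sX (exist _ c ac) cq.
by move=> /(msmooth_at_chart _ ac cq).1.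
Qed.

Variables (m n r : nat) (N : manifold R m) (M : manifold R n).
Variables (f : N -> M) (sf : smooth_map f).

Lemma derive_pushed p (X : section (TM N)) (g : 'I_r -> N -> R^o)
    (Z : 'I_r -> section (TM M)) (v : TM N p) :
  ssmooth_at p X -> (forall k, msmooth_at p (g k)) ->
  (forall k, ssmooth_at (f p) (Z k)) ->
  (\forall q \near p, mdiff f (X q) = \sum_k (g k q : R) *: Z k (f q)) ->
  let c := chart_at p in let d := chart_at (f p) in
  'D_(v : 'rV[R]_m) (fun y => 'D_(vf_coord c X y) (cmap d \o f \o cinv c) y) (cmap c p) =
  \sum_k ((g k p : R) *: 'D_(mdiff f v : 'rV[R]_n) (vf_coord d (Z k)) (cmap d (f p))
          + dirder v (g k) *: Z k (f p)).
Proof.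
move=> sX sg sZ XE c d.
have [cp dp] : cdom c p /\ cdom d (f p) by split; exact: cdom_at.
have [ac ad] : atlas c /\ atlas d by split; exact: atlas_at.
have s1 := smooth_map_at sf ac ad cp dp.
set phi := cmap d \o f \o cinv c in s1 *.
have pE : phi (cmap c p) = cmap d (f p) by rewrite /phi /= cmapK.
have sZ' k : smooth_at (phi (cmap c p)) (vf_coord d (Z k)).
  by rewrite pE; exact: vf_coord_smooth.
have sZ2 k : smooth_at (cmap c p) (fun y => vf_coord d (Z k) (phi y)).
  by apply: smooth_at_comp.
transitivity ('D_(v : 'rV[R]_m) (fun y => \sum_k (g k \o cinv c) y *:
    vf_coord d (Z k) (phi y)) (cmap c p)).
  apply: near_eq_derive.
  have N2 : \forall q \near p, [/\ cdom c q, cdom d (f q) &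
      mdiff f (X q) = \sum_k (g k q : R) *: Z k (f q)].
    by apply: filterS3 (near_cdom cp) (near_pullback sf (near_cdom dp)) XE => q.
  have := near_cinv cp N2; apply: filterS2 (near_cimg cp) => _ [q cq <-].
  rewrite cmapK// => -[_ dq Xq]; rewrite vf_coordE//.
  apply: etrans (esym (mdiff_chart sf (X q) ac ad cq dq)) _.
  rewrite Xq linear_sum; apply: eq_bigr => k _.
  rewrite linearZ (_ : phi (cmap c q) = cmap d (f q)); last by rewrite /phi /= cmapK.
  by rewrite (vf_coordE _ dq) [in RHS]/comp (cmapK cq).
rewrite derive_bigsum; last by move=> k; exact: smooth_atZ (sg k) (sZ2 k).
apply: eq_bigr => k _.
have [_ ->] := derive_scale (smooth_at_differentiable (sg k))
  (smooth_at_differentiable (sZ2 k)).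
have EZ : 'D_(v : 'rV[R]_m) (fun y => vf_coord d (Z k) (phi y)) (cmap c p) =
    'D_(mdiff f v : 'rV[R]_n) (vf_coord d (Z k)) (cmap d (f p)).
  have := derive_chain (v : 'rV[R]_m) (smooth_at_differentiable s1)
    (smooth_at_differentiable (sZ' k)).
  by rewrite pE.
by rewrite EZ pE vf_coord_at [(g k \o cinv c) _]/comp (cmapK cp).
Qed.

(** In charts [df [X, Y] = X (df Y) - Y (df X)]; inserting the expansions of [df X] and
    [df Y] gives brackets of the [Z k] and derivatives of the coefficients. Since the
    coefficients live on [N], this covers vector fields that are not projectable. *)
Lemma mdiff_bracket p (X Y : section (TM N)) (g h : 'I_r -> N -> R^o)
    (Z : 'I_r -> section (TM M)) :
  ssmooth_at p X -> ssmooth_at p Y ->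
  (forall k, msmooth_at p (g k)) -> (forall k, msmooth_at p (h k)) ->
  (forall k, ssmooth_at (f p) (Z k)) ->
  (\forall q \near p, mdiff f (X q) = \sum_k (g k q : R) *: Z k (f q)) ->
  (\forall q \near p, mdiff f (Y q) = \sum_k (h k q : R) *: Z k (f q)) ->
  mdiff f (lie_bracket X Y p) =
  \sum_k (dirder (X p) (h k) - dirder (Y p) (g k)) *: Z k (f p) +
  \sum_k \sum_l ((h k p : R) * g l p) *: lie_bracket (Z l) (Z k) (f p).
Proof.
move=> sX sY sg sh sZ XE YE.
set c := chart_at p; set d := chart_at (f p).
have [cp dp] : cdom c p /\ cdom d (f p) by split; exact: cdom_at.
have [ac ad] : atlas c /\ atlas d by split; exact: atlas_at.
have s1 := smooth_map_at sf ac ad cp dp.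
have := derive_bracket s1 (vf_coord_smooth ac cp sX) (vf_coord_smooth ac cp sY).
rewrite !vf_coord_at => Ebr; apply: etrans Ebr _.
apply: etrans (congr2 (fun u w => u - w) (derive_pushed (X p) sY sh sZ YE)
  (derive_pushed (Y p) sX sg sZ XE)) _.
rewrite (nbhs_singleton XE) (nbhs_singleton YE) -/d.
pose DZ l k : 'rV[R]_n := 'D_(Z l (f p) : 'rV[R]_n) (vf_coord d (Z k)) (cmap d (f p)).
have DE (a : 'I_r -> R) k :
    'D_(\sum_l a l *: (Z l (f p) : 'rV[R]_n)) (vf_coord d (Z k)) (cmap d (f p)) =
    \sum_l a l *: DZ l k.
  have dZ := smooth_at_differentiable (vf_coord_smooth ad dp (sZ k)).
  rewrite deriveE// linear_sum; apply: eq_bigr => l _.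
  by rewrite linearZ /DZ deriveE.
under eq_bigr do rewrite DE.
under [X in _ - X]eq_bigr do rewrite DE.
rewrite !big_split /= opprD addrACA addrC; congr (_ + _).
  by rewrite -sumrB; apply: eq_bigr => k _; rewrite scalerBl.
rewrite /lie_bracket -/d.
under [RHS]eq_bigr => k _ do under eq_bigr => l _ do rewrite scalerBr.
under [RHS]eq_bigr => k _ do rewrite sumrB.
rewrite sumrB; congr (_ - _).
  apply: eq_bigr => k _; rewrite scaler_sumr; apply: eq_bigr => l _.
  by rewrite scalerA.
rewrite exchange_big /=; apply: eq_bigr => k _; rewrite scaler_sumr.
by apply: eq_bigr => l _; rewrite scalerA mulrC.
Qed.

End VectorFields.

(** * Pulled-back connections *)

Section PullbackConnection.
Context {R : realType}.
Variables (m n r : nat) (N : manifold R m) (M : manifold R n) (E : vbundle M r).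
Variables (f : N -> M) (sf : smooth_map f).
Variables (D : covder E) (hD : is_connection D).
Arguments D : clear implicits.
Local Notation fE := (pullback E sf).
Local Notation fD := (pullback_covder sf D).
Implicit Types (p : N).

Lemma ssmooth_at_pull p (s : section E) : ssmooth_at (f p) s ->
  ssmooth_at p ((fun q => s (f q)) : section fE).
Proof.
move=> ss i ip.
pose g (y : M) := @triv _ _ _ _ E i y (s y).
have sg : msmooth_at (f p) g by exact: ss i ip.
exact: (msmooth_at_comp sf sg).
Qed.

Lemma ssmooth_at_frame y (i : tidx E) k : tdom i y -> ssmooth_at y (frame i k).
Proof. exact: ssmooth_at_trivV. Qed.

Lemma pullback_covderE p (v : TM N p) (s : section fE) :
  fD p v s = \sum_(k < r)
    (dirder v (fun q => triv (triv_at E (f p)) (f q) (s q) 0 k) *: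
       frame (triv_at E (f p)) k (f p) +
     triv (triv_at E (f p)) (f p) (s p) 0 k *:
       D (f p) (mdiff f v) (frame (triv_at E (f p)) k)).
Proof. by []. Qed.

Lemma pullback_covder_local p (v : TM N p) (s t : section fE) :
  (\forall q \near p, s q = t q) -> fD p v s = fD p v t.
Proof.
move=> st; rewrite !pullback_covderE; apply: eq_bigr => k _.
rewrite (nbhs_singleton st); congr (_ *: _ + _); apply: dirder_eq.
by apply: filterS st => q ->.
Qed.

Lemma pullback_covder_vertical p (v : TM N p) (s : section fE) : mdiff f v = 0 ->
  fD p v s = \sum_(k < r)
    dirder v (fun q => triv (triv_at E (f p)) (f q) (s q) 0 k) *:
      frame (triv_at E (f p)) k (f p).
Proof.
move=> v0; rewrite pullback_covderE; apply: eq_bigr => k _.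
by rewrite v0 (conn_vec0 hD) ?scaler0 ?addr0//; exact/ssmooth_at_frame/tdom_at.
Qed.

Lemma pullback_covder_pull p (v : TM N p) (s : section E) : ssmooth_at (f p) s ->
  fD p v (fun q => s (f q)) = D (f p) (mdiff f v) s.
Proof.
move=> ss; rewrite pullback_covderE; set i := triv_at E (f p).
have ip : tdom i (f p) by exact: tdom_at.
pose a k (y : M) : R^o := triv i y (s y) 0 k.
have sa k : msmooth_at (f p) (a k) by exact: msmooth_at_component.
have sF k : ssmooth_at (f p) (frame i k) by exact: ssmooth_at_frame.
transitivity (D (f p) (mdiff f v) (fun y => \sum_k (a k y : R) *: frame i k y)).
  rewrite (conn_sum hD)//; apply: eq_bigr => k _.
  by rewrite (dirder_comp sf).
apply: (conn_local hD).
  by apply: ssmooth_at_sum => k; exact: ssmooth_atZ.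
by apply: filterS (near_tdom ip) => y iy; rewrite -frame_sum.
Qed.

Lemma pullback_covder_sum p (v : TM N p) (I : finType) (g : I -> N -> R^o)
    (s : I -> section fE) :
  (forall i, msmooth_at p (g i)) -> (forall i, ssmooth_at p (s i)) ->
  fD p v (fun q => \sum_i (g i q : R) *: s i q) =
  \sum_i (dirder v (g i) *: s i p + (g i p : R) *: fD p v (s i)).
Proof.
move=> sg ss; set i := triv_at E (f p).
have ip : tdom i (f p) by exact: tdom_at.
pose a l k (q : N) : R^o := triv i (f q) (s l q) 0 k.
have sa l k : msmooth_at p (a l k).
  exact: (@msmooth_at_component _ _ _ _ fE i p (s l) k ip (ss l)).
rewrite pullback_covderE -/i.
have aE k q : triv i (f q) (\sum_l (g l q : R) *: s l q) 0 k = \sum_l g l q * a l k q.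
  by rewrite linear_sum summxE; apply: eq_bigr => l _; rewrite linearZ !mxE.
transitivity (\sum_k \sum_l
   ((g l p * dirder v (a l k) + dirder v (g l) * a l k p) *: frame i k (f p) +
    (g l p * a l k p) *: D (f p) (mdiff f v) (frame i k))).
  apply: eq_bigr => k _; rewrite aE big_split /= -!scaler_suml; congr (_ *: _ + _).
  under eq_bigr => l _ do rewrite -(dirderM v (sg l) (sa l k)).
  rewrite -dirder_sum; last by move=> l; exact: msmooth_atM.
  by congr dirder; apply/funext => q; exact: aE.
rewrite exchange_big; apply: eq_bigr => l _ /=.
rewrite pullback_covderE -/i.
rewrite [X in _ = _ *: X + _](@frame_sum _ _ _ _ _ i (f p) (s l p) ip).
rewrite !scaler_sumr -big_split; apply: eq_bigr => k _ /=.
by rewrite scalerDl scalerDr !scalerA -addrA addrCA.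
Qed.

End PullbackConnection.

(** * Descent along submersions and foliations *)

Section Descent.
Context {R : realType}.

Lemma derive_line_const (V W : normedModType R) (f : V -> W) z v :
  differentiable f z -> (\forall s \near (0 : R), f (z + s *: v) = f z) ->
  'D_v f z = 0.
Proof.
move=> df fz; have dl : derivable f (z + (0 : R) *: v) v.
  by rewrite scale0r addr0; exact: diff_derivable.
have := derivable_line dl; rewrite scale0r addr0 => /(@derive_val _ _ _ _ _ _ _) <-.
have <- : 'D_1 (cst (f z) : R -> W) (0 : R) = 0 by exact: derive_cst.
exact: near_eq_derive.
Qed.

(** A submersion has smooth local sections, and composing [g \o f] with one of them
    recovers [g]. *)
Lemma submersion_descend (m n : nat) (N : manifold R m) (M : manifold R n)
    (f : N -> M) (sf : smooth_map f) (V : normedModType R) (g : M -> V) (p : N) :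
  (forall w : TM M (f p), exists v : TM N p, mdiff f v = w) ->
  msmooth_at p (g \o f) -> msmooth_at (f p) g.
Proof.
move=> surj sg; set c := chart_at p; set d := chart_at (f p).
have [cp dp] : cdom c p /\ cdom d (f p) by split; exact: cdom_at.
have s1 := smooth_map_at sf (atlas_at p) (atlas_at (f p)) cp dp.
have pE : (cmap d \o f \o cinv c) (cmap c p) = cmap d (f p) by rewrite /= cmapK.
have [s] := local_section s1 surj; rewrite pE => -[ss s0 sE].
have s2 := @smooth_at_comp _ _ _ _ _ s ((g \o f) \o cinv c) ss.
rewrite s0 in s2; apply: smooth_at_eq (s2 sg).
have N1 := near_cinv cp (near_pullback sf (near_cdom dp)).
have N2 : \forall y \near cmap d (f p), cdom d (f (cinv c (s y))).
  by rewrite -s0 in N1; exact: smooth_at_continuous ss _ N1.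
apply: filterS2 N2 sE => y dy sy.
by rewrite /= -[in RHS]sy /= cmapK.
Qed.

End Descent.

Section Foliations.
Context {R : realType}.
Variables (q0 r : nat) (P : manifold R (q0 + r)) (L : foliation P).
Variables (n : nat) (M : manifold R n) (f : P -> M) (sf : smooth_map f).
Hypothesis leaves : forall p q, same_leaf L p q -> f p = f q.

(** In a foliated chart a plaque is a slice of a ball, hence convex, and two of its points
    are joined by a segment whose directions are vertical; the mean value theorem applies
    along it. *)
Lemma leafwise_constant (g : P -> R^o) (p : P) :
  (forall q, f q = f p -> msmooth_at q g) ->
  (forall q (w : TM P q), f q = f p -> mdiff f w = 0 -> dirder w g = 0) ->
  forall q, same_leaf L p q -> g q = g p.
Proof.
move=> sg vg q; elim=> // c b b' pb IH Lc cb cb' bb'; rewrite -IH {IH}.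
have fb : f b = f p by rewrite (leaves pb).
have [x1 [e [e0 cE]]] := fol_cube Lc.
set x := cmap c b; set y := cmap c b'.
have [xB yB] : ball x1 e x /\ ball x1 e y by rewrite -cE; split; [exists b|exists b'].
have fz a : cdom c a -> lsubmx (cmap c a) = lsubmx x -> f a = f p.
  by move=> ca ax; rewrite (leaves (same_leaf_step pb Lc cb ca (esym ax))).
have lz (t : R) z : lsubmx z = lsubmx x -> lsubmx (z + t *: (y - x)) = lsubmx x.
  by move=> zx; rewrite linearD linearZ linearB /= zx -/x bb' subrr scaler0 addr0.
pose G := g \o cinv c.
have dG (t : R) : 0 <= t <= 1 -> differentiable G (x + t *: (y - x)) /\
    'D_(y - x) G (x + t *: (y - x)) = 0.
  move=> ht; have := ball_convex ht xB yB; have := lz t x erefl.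
  set z := x + _ => lzx; rewrite -cE => -[a ca az].
  have fa : f a = f p by apply: fz => //; rewrite az.
  have ac := fol_compatible Lc (atlas_at a).
  have da := cdom_at a.
  have sG : smooth_at z G.
    by rewrite -az; exact: change_chart ac.1 ca da (sg _ fa).
  split; first exact: smooth_at_differentiable.
  (* The direction of the segment at [a]: it is vertical, since [f] is constant on
     the plaque. *)
  pose w : TM P a := 'D_(y - x) (cmap (chart_at a) \o cinv c) (cmap c a).
  rewrite -az; have E1 := derive_change_chart (G := g) (y - x) ac.1 ca da (sg _ fa).
  apply: etrans (esym E1) (vg a w fa _).
  have s1 := smooth_map_at sf (atlas_at a) (atlas_at (f a)) da (cdom_at (f a)).
  have := derive_change_chart (G := cmap (chart_at (f a)) \o f) (y - x) ac.1 ca da s1.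
  move=> E; apply: etrans E _; apply: derive_line_const.
    by apply: smooth_at_differentiable; exact: change_chart ac.1 ca da s1.
  have zB : ball x1 e z by rewrite -cE -az; exists a.
  have N1 : \forall s \near (0 : R), ball x1 e (z + s *: (y - x)).
    have cl : {for (0 : R), continuous (fun s : R => z + s *: (y - x))}.
      apply: continuousD; first exact: cst_continuous.
      exact: scalel_continuous.
    apply: cl; rewrite scale0r addr0; apply: open_nbhs_nbhs; split=> //.
    exact: ball_open.
  apply: filterS N1 => s; rewrite -cE az => -[a' ca' a'z].
  rewrite /= -a'z cmapK// -az cmapK// fa fz// a'z.
  exact: lz.
have [t ht] := mvt_line (fun t ht => (dG t ht).1).
rewrite (dG t ht).2 addrCA subrr addr0 /G /= !cmapK// => /eqP.
by rewrite subr_eq0 => /eqP.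
Qed.

End Foliations.

(** * Flatness and closed contractions *)

Section ExactContraction.
Context {R : realType}.
Variables (n r : nat) (M : manifold R n) (E F : vbundle M r).
Variables (DE : covder E) (DF : covder F).
Arguments DE : clear implicits.
Arguments DF : clear implicits.
Hypotheses (hDE : is_connection DE) (hDF : is_connection DF).
Variables (xi : bmap E (TM M)) (omega : twoform F) (a : bmap E F).
Hypothesis a_primitive : forall (X : section (TM M)) (e : section E),
  smooth_section X -> smooth_section e -> forall x,
  contract2 xi omega (X x) (e x) = - hom_covder DE DF (fun y => a y) (X x) e.

(** Both sides only involve the vector [v] and the germ of [e], so the identity passes
    from global fields and sections to these. *)
Lemma exact_germ x (v : TM M x) (e : section E) : ssmooth_at x e ->
  omega x (xi x (e x)) v = a x (DE x v e) - DF x v (fun y => a y (e y)).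
Proof.
move=> se; have [X sX Xx] := extend_vector v.
have [e' se' ee] := extend_section se.
have e's : ssmooth_at x e' by move/smooth_sectionP : se'; exact.
have := a_primitive sX se' x; rewrite /contract2 /hom_covder Xx (nbhs_singleton ee) => ->.
rewrite opprB (conn_local hDE v e's ee); congr (_ - _).
apply: (conn_local hDF); first exact: (ssmooth_at_bmap a).
by apply: filterS ee => y ->.
Qed.

(** [A1] and [A2] stand for [D_X (a D_Y e)] and [D_Y (a D_X e)], [B1] and [B2] for the
    second derivatives of [a e], [C2] and [C1] for the images under [a] of those of [e]. *)
Lemma curvature_cancel (V : zmodType) (A1 A2 B1 B2 C1 C2 : V) :
  (A1 - B1 - (C1 - A2)) - (A2 - B2 - (C2 - A1)) - ((C2 - C1) - (B1 - B2)) = 0.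
Proof.
rewrite (opprB C1) (opprB C2) (opprB B1) !(addrACA _ (- _)) -!opprD.
rewrite (addrC A2 A1) (addrC C2 B2) (addrC C1 B1) opprB [X in X - _]addrC subrKA.
exact: subrr.
Qed.

(** Up to sign this is [d (d a)], the difference of the actions on [a] of the curvatures
    of the two connections. *)
Lemma flat_exact_closed (flatE : is_flat DE) (flatF : is_flat DF)
    (X Y : section (TM M)) (e : section E) :
  smooth_section X -> smooth_section Y -> smooth_section e -> forall x,
  ext_d1_hom DE DF (contract2 xi omega) X Y e x = 0.
Proof.
move=> sX sY se x.
have ae : smooth_section (fun y => a y (e y) : F y) by exact: smooth_section_bmap.
have bE (Z : section (TM M)) (e' : section E) y : smooth_section e' ->
    contract2 xi omega (Z y) (e' y) =
    a y (DE y (Z y) e') - DF y (Z y) (fun z => a z (e' z)).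
  by move=> /smooth_sectionP/(_ y); exact: exact_germ.
have at_x s2 (V : vbundle M s2) (s : section V) : smooth_section s -> ssmooth_at x s.
  by move=> /smooth_sectionP.
have homE (Z W : section (TM M)) : smooth_section Z -> smooth_section W ->
    hom_covder DE DF (fun q => contract2 xi omega (W q)) (Z x) e =
    (DF x (Z x) (fun q => a q (DE q (W q) e))
       - DF x (Z x) (fun q => DF q (W q) (fun y => a y (e y))))
    - (a x (DE x (W x) (fun q => DE q (Z q) e))
       - DF x (W x) (fun q => a q (DE q (Z q) e))).
  move=> sZ sW; rewrite /hom_covder.
  have sZe := ssmooth_at_conn hDE sZ se; have sWe := ssmooth_at_conn hDE sW se.
  have -> : (fun q => contract2 xi omega (W q) (e q)) =
      (fun q => a q (DE q (W q) e) - DF q (W q) (fun y => a y (e y))).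
    by apply: functional_extensionality_dep => q; exact: bE.
  rewrite (connB hDF); last 2 first.
  - exact/at_x/(smooth_section_bmap a).
  - exact/at_x/(ssmooth_at_conn hDF).
  by congr (_ - _); exact: (bE W (fun q => DE q (Z q) e)).
rewrite /ext_d1_hom !homE//.
have brE : contract2 xi omega (lie_bracket X Y x : TM M x) (e x) =
    a x (DE x (lie_bracket X Y x) e) - DF x (lie_bracket X Y x) (fun z => a z (e z)).
  by apply: exact_germ; exact: at_x.
rewrite brE.
have /subr0_eq brE' := flatE X Y e sX sY se x.
have /subr0_eq brF := flatF X Y _ sX sY ae x.
rewrite -brE' -brF (linearB (a x)).
exact: curvature_cancel.
Qed.

End ExactContraction.

(** * Lifts determine a primitive of the contraction *)

Lemma twoform_antisym (R : realType) n (M : manifold R n) r (V : vbundle M r)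
    (w : twoform V) x (u v : TM M x) : w x u v = - w x v u.
Proof.
have H := twoform_alternate w (u + v).
have L := twoform_linear w (u + v) 1 u v.
have L1 := twoform_linearl w u 1 u v.
have L2 := twoform_linearl w v 1 u v.
rewrite !scale1r in L L1 L2.
move: H; rewrite L L1 L2 !twoform_alternate add0r addr0 addrC => /eqP.
by rewrite addr_eq0 => /eqP.
Qed.

Lemma twoform0r (R : realType) n (M : manifold R n) r (V : vbundle M r)
    (w : twoform V) x (u : TM M x) : w x u 0 = 0.
Proof.
have := twoform_linear w u 1 0 0; rewrite scaler0 addr0 scale1r => /eqP.
by rewrite -subr_eq subrr eq_sym => /eqP.
Qed.

Lemma torsion_cancel (V : zmodType) (A B p1 p2 w : V) :
  A - B - (p1 - p2) = w -> A - p1 = w -> B - p2 = - w -> w = 0.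
Proof.
have -> : A - B - (p1 - p2) = (A - p1) - (B - p2).
  by rewrite opprB opprB addrACA [RHS]addrACA (addrC (- B)).
by move=> H Ap Bp; move: H; rewrite Ap Bp opprK -{3}[w]addr0 => /addrI.
Qed.

Section ShearSpace.
Variables (R : realType) (n r : nat) (M : manifold R n).
Variables (E F : vbundle M r) (DE : covder E) (DF : covder F).
Arguments DE : clear implicits.
Arguments DF : clear implicits.
Hypotheses (hDE : is_connection DE) (hDF : is_connection DF).
Variables (xi : bmap E (TM M)) (omega : twoform F).
Variable (P : shear_total_space DF omega).

Local Notation pr := (sts_proj P).
Local Notation sP := (sts_smooth P).
Local Notation PE := (pullback E sP).
Local Notation PF := (pullback F sP).
Local Notation DPE := (pullback_covder sP DE).
Local Notation DPF := (pullback_covder sP DF).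
Local Notation theta := (sts_theta P).

Section Forward.
Variable xi' : bmap PE (TM P).
Hypothesis cov : forall (p : P) (e : E (pr p)), mdiff pr (xi' p e) = xi (pr p) e.
Hypothesis theta_preserved : forall (X : section (TM P)) (e : section PE),
  smooth_section X -> smooth_section e -> forall p,
  lie_derivative1 DPE DPF xi' theta X e p = 0.

(** It will turn out to be the pull-back of a bundle map over [M], see
    [pairing_descends]. *)
Definition pairing (p : P) (e : E (pr p)) : F (pr p) := theta p (xi' p e).

Lemma pairing0 p : pairing (0 : E (pr p)) = 0.
Proof. exact: etrans (congr1 (theta p) (linear0 (xi' p))) (linear0 (theta p)). Qed.

Lemma ssmooth_at_pairing p (e : section PE) : ssmooth_at p e ->
  ssmooth_at p ((fun q => pairing (e q)) : section PF).
Proof. by move=> se; apply: (ssmooth_at_bmap theta); exact: (ssmooth_at_bmap xi'). Qed.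

(** The Lie derivative of [theta] is [d (xi' _| theta) + xi' _| d theta], and [d theta] is
    the pull-back of [omega]. *)
Lemma pairing_derivative p (v : TM P p) (e : section PE) : ssmooth_at p e ->
  DPF p v (fun q => pairing (e q)) - pairing (DPE p v e) =
  - omega (pr p) (xi (pr p) (e p)) (mdiff pr v).
Proof.
move=> se; have [X sX Xp] := extend_vector v.
have [e' se' ee] := extend_section se.
have := theta_preserved sX se' p.
rewrite /lie_derivative1 /hom_covder /contract1 (sts_d_theta (s := P)); last first.
- exact: sX.
- exact: (smooth_section_bmap xi').
rewrite cov Xp (nbhs_singleton ee) (pullback_covder_local DE v ee) => /eqP.
rewrite addr_eq0 => /eqP <-; congr (_ - _).
by apply: pullback_covder_local; apply: filterS ee => q ->.
Qed.

(** Evaluating [theta] on the torsion identity of the lift gives [2 w = w], where [w] is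
    the value of [omega] on [xi e1] and [xi e2]: the derivative of the pairing contributes
    [w] twice, and [d theta] once. *)
Lemma torsion_free_isotropic : torsion_free DPE xi' ->
  forall x (e1 e2 : E x), omega x (xi x e1) (xi x e2) = 0.
Proof.
move=> tf x; have [p <-] := sts_surjective P x => e1 e2.
have [s1 ss1 s1p] := @extend_vector _ _ _ _ PE p e1.
have [s2 ss2 s2p] := @extend_vector _ _ _ _ PE p e2.
have sX1 := smooth_section_bmap xi' ss1; have sX2 := smooth_section_bmap xi' ss2.
have brE : theta p (lie_bracket (fun q => xi' q (s1 q)) (fun q => xi' q (s2 q)) p) =
    pairing (DPE p (xi' p (s1 p)) s2) - pairing (DPE p (xi' p (s2 p)) s1).
  rewrite -(tf s1 s2 ss1 ss2 p).
  exact: etrans (congr1 (theta p) (linearB (xi' p) _ _)) (linearB (theta p) _ _).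
have := sts_d_theta sX1 sX2 p; rewrite /ext_d1 brE !cov s1p s2p.
set w := omega _ _ _.
have at_p (s : section PE) : smooth_section s -> ssmooth_at p s by move=> /smooth_sectionP.
have E2 := pairing_derivative (xi' p (s1 p)) (at_p _ ss2).
have E1 := pairing_derivative (xi' p (s2 p)) (at_p _ ss1).
rewrite !cov s1p s2p twoform_antisym opprK -/w in E2.
rewrite !cov s1p s2p -/w in E1.
by move=> E0; exact: torsion_cancel E0 E2 E1.
Qed.

(** Coordinates with respect to trivialisations over [M] allow the values at different
    points of a fibre of [P] to be compared. *)
Definition pairing_coord (i : tidx E) (j : tidx F) (u : 'rV[R]_r) (q : P) : 'rV[R]_r :=
  triv j (pr q) (pairing (trivV i (pr q) u)).

Lemma pairing_coord_smooth (i : tidx E) (j : tidx F) u q :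
  tdom i (pr q) -> tdom j (pr q) -> msmooth_at q (pairing_coord i j u).
Proof.
move=> iq jq.
have se := @ssmooth_at_trivV _ _ _ _ PE i q u iq.
exact: (ssmooth_at_pairing se) j jq.
Qed.

(** In pulled-back frames, covariant derivatives along a vertical vector are derivatives
    of coordinates, and the term in [omega] is contracted with the zero vector. *)
Lemma pairing_coord_vertical q (w : TM P q) u k : mdiff pr w = 0 ->
  dirder w (fun q' => pairing_coord (triv_at E (pr q)) (triv_at F (pr q)) u q' 0 k) = 0.
Proof.
move=> w0; set i := triv_at E (pr q); set j := triv_at F (pr q).
have [iq jq] : tdom i (pr q) /\ tdom j (pr q) by split; exact: tdom_at.
have se := @ssmooth_at_trivV _ _ _ _ PE i q u iq.
have := pairing_derivative w se.
rewrite w0 twoform0r oppr0 (pullback_covder_vertical hDE _ w0).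
rewrite big1 => [|l _]; last first.
  rewrite (_ : dirder _ _ = 0) ?scale0r// -[RHS](dirder_cst w (u 0 l)).
  apply: dirder_eq; apply: filterS (@near_tdom _ _ _ _ PE i q iq) => q' iq'.
  by rewrite trivVK.
rewrite [pairing _]pairing0 subr0 (pullback_covder_vertical hDF _ w0).
move=> /(congr1 (triv j (pr q))); rewrite linear0 linear_sum => /rowP/(_ k).
rewrite mxE summxE (bigD1 k)//= big1 => [|l lk].
  rewrite addr0 linearZ /= -/j triv_frame// !mxE !eqxx mulr1; exact.
by rewrite linearZ /= -/j triv_frame// !mxE eqxx eq_sym (negPf lk) mulr0.
Qed.

Lemma pairing_coord_leaf p q u : pr q = pr p ->
  pairing_coord (triv_at E (pr p)) (triv_at F (pr p)) u q =
  pairing_coord (triv_at E (pr p)) (triv_at F (pr p)) u p.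
Proof.
move=> qp; apply/rowP => k.
have pq : same_leaf (sts_foliation P) p q by apply/sts_leaves.
have leaves a b : same_leaf (sts_foliation P) a b -> pr a = pr b by move/sts_leaves.
apply: (leafwise_constant sP leaves (g := fun q' =>
  pairing_coord (triv_at E (pr p)) (triv_at F (pr p)) u q' 0 k) _ _ pq) => b => [bp|w bp w0].
  apply: msmooth_at_coord; apply: pairing_coord_smooth; rewrite bp; exact: tdom_at.
by rewrite -bp; exact: pairing_coord_vertical.
Qed.

(** The coordinates are constant along the leaves, which are the fibres of the
    projection, and the resulting bundle map is smooth by [submersion_descend]. *)
Lemma pairing_descends : exists a : bmap E F,
  forall (p : P) (e : E (pr p)), pairing e = a (pr p) e.
Proof.
have /choice[pt ptE] := sts_surjective P.
pose af x (e : E x) : F x := trivV (triv_at F x) x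
  (pairing_coord (triv_at E x) (triv_at F x) (triv (triv_at E x) x e) (pt x)).
have lin x : linear (af x).
  move=> c u v; rewrite /af /pairing_coord /pairing.
  by rewrite !linearP.
pose afl x : {linear E x -> F x} :=
  HB.pack (af x) (GRing.isLinear.Build _ _ _ _ (af x) (lin x)).
have desc (p : P) (e : E (pr p)) : pairing e = af (pr p) e.
  rewrite /af pairing_coord_leaf; last exact: ptE.
  by rewrite /pairing_coord !trivK//; exact: tdom_at.
have sm (i : tidx E) (u : 'rV[R]_r) :
    smooth_section_on (tdom i) (fun x => afl x (trivV i x u) : F x).
  apply/(smooth_section_onP _ (tdom_open i)) => x ix.
  have jx := tdom_at F x; apply: (ssmooth_at_triv jx).
  have [p px] := sts_surjective P x; move: ix jx; rewrite -px => ix jx.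
  apply: (submersion_descend sP (p := p)); first exact: sts_submersion.
  apply: (msmooth_at_eq _ (pairing_coord_smooth u ix jx)).
  by apply: filterE => q; rewrite /pairing_coord desc.
by exists (BMap sm).
Qed.

Lemma pairing_exact (a : bmap E F) :
  (forall (p : P) (e : E (pr p)), pairing e = a (pr p) e) ->
  forall (X : section (TM M)) (e : section E),
    smooth_section X -> smooth_section e -> forall x,
    contract2 xi omega (X x) (e x) = - hom_covder DE DF (fun y => a y) (X x) e.
Proof.
move=> desc X e sX /smooth_sectionP se x.
have [p <-] := sts_surjective P x; have [v vX] := sts_submersion (X (pr p)).
have := pairing_derivative v (ssmooth_at_pull (sf := sP) (se (pr p))).
rewrite (pullback_covder_pull sP hDE)// desc.
have -> : (fun q : P => pairing (e (pr q))) = (fun q => (fun y => a y (e y)) (pr q)).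
  by apply: functional_extensionality_dep => q; exact: desc.
have sae : ssmooth_at (pr p) ((fun y => a y (e y)) : section F).
  exact: (ssmooth_at_bmap a).
rewrite (pullback_covder_pull sP hDF v sae).
by rewrite vX /hom_covder /contract2 => ->; rewrite opprK.
Qed.

End Forward.
End ShearSpace.

(** * Lifts built from a primitive *)

Section PullbackSections.
Context {R : realType}.
Variables (m n : nat) (N : manifold R m) (M : manifold R n).
Variables (f : N -> M) (sf : smooth_map f).

Lemma ssmooth_at_pull_bmap r1 r2 (E : vbundle M r1) (F : vbundle M r2)
    (b : bmap E F) p (e : section (pullback E sf)) : ssmooth_at p e ->
  ssmooth_at p ((fun q => b (f q) (e q)) : section (pullback F sf)).
Proof.
move=> se; have ip := tdom_at E (f p); set i := triv_at E (f p) in ip.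
apply: (@ssmooth_at_eq _ _ _ _ (pullback F sf) _ (fun q =>
    \sum_k (triv i (f q) (e q) 0 k : R^o) *: b (f q) (frame i k (f q)))).
  have ip' : @tdom _ _ _ _ (pullback E sf) i p by [].
  apply: filterS (near_tdom ip') => q iq.
  by rewrite [in RHS](frame_sum (e q : E (f q)) iq) linear_sum;
    apply: eq_bigr => k _; rewrite linearZ.
apply: ssmooth_at_sum => k; apply: ssmooth_atZ.
  exact: (@msmooth_at_component _ _ _ _ (pullback E sf) i p e k ip se).
have sb := ssmooth_at_bmap b (ssmooth_at_frame k ip).
exact: (@ssmooth_at_pull _ _ _ _ _ _ F f sf p (fun y => b y (frame i k y)) sb).
Qed.

Lemma ssmooth_at_mdiff p (X : section (TM N)) : ssmooth_at p X ->
  ssmooth_at p ((fun q => mdiff f (X q)) : section (pullback (TM M) sf)).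
Proof.
move=> sX; set c := chart_at p; set d := chart_at (f p).
have [cp dp] : cdom c p /\ cdom d (f p) by split; exact: cdom_at.
have [ac ad] : atlas c /\ atlas d by split; exact: atlas_at.
pose i : tidx (pullback (TM M) sf) := exist _ d ad.
apply: (@ssmooth_at_triv _ _ _ _ (pullback (TM M) sf) i) => //.
apply: (smooth_at_eq _ (smooth_at_derive_along (vf_coord_smooth ac cp sX)
  (smooth_map_at sf ac ad cp dp))).
have N1 : \forall q \near p, cdom c q /\ cdom d (f q).
  by apply: filterS2 (near_cdom cp) (near_pullback sf (near_cdom dp)) => q.
apply: filterS2 (near_cimg cp) (near_cinv cp N1) => _ [q cq <-].
rewrite (cmapK cq) => -[_ dq]; rewrite vf_coordE//.
rewrite -(mdiff_chart sf (X q) ac ad cq dq).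
by rewrite /= (cmapK cq).
Qed.

End PullbackSections.

Section ShearLift.
Variables (R : realType) (n r : nat) (M : manifold R n).
Variables (E F : vbundle M r) (DE : covder E) (DF : covder F).
Arguments DE : clear implicits.
Arguments DF : clear implicits.
Hypotheses (hDE : is_connection DE) (hDF : is_connection DF).
Variables (xi : bmap E (TM M)) (omega : twoform F).
Variable (P : shear_total_space DF omega).

Local Notation pr := (sts_proj P).
Local Notation sP := (sts_smooth P).
Local Notation PE := (pullback E sP).
Local Notation PF := (pullback F sP).
Local Notation DPE := (pullback_covder sP DE).
Local Notation DPF := (pullback_covder sP DF).
Local Notation theta := (sts_theta P).
Local Notation rho := (sts_rho P).

(** Lift [w] arbitrarily, then correct the value of [theta] along the image of [rho]. *)
Lemma proj_theta_surjective (p : P) (w : TM M (pr p)) (u : F (pr p)) :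
  exists v : TM P p, mdiff pr v = w /\ theta p v = u.
Proof.
have [v0 v0w] := sts_submersion w.
exists (1 *: (v0 : TM P p) + rho p (u - theta p v0)); split.
  by rewrite (mdiff_is_linear sP) scale1r (sts_proj_rho (s := P)) addr0.
rewrite linearP scale1r (sts_theta_rho (s := P)).
by rewrite addrC subrK.
Qed.

Section Splitting.
Variables (c : chart R (n + r) P) (d : chart R n M) (j : tidx F).
Hypotheses (ac : atlas c) (ad : atlas d).

Definition proj_theta_row q (v : TM P q) : 'rV[R]_(n + r) :=
  row_mx (chart_diff (chart_at (pr q)) d (pr q) (mdiff pr v)) (triv j (pr q) (theta q v)).

Let ic : tidx (TM P) := exist _ c ac.

(** The matrix of [(d pi, theta)] in a chart of [P], a chart of [M] and a trivialisation
    of [F]. *)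
Definition proj_theta_mx q : 'M[R]_(n + r) := \matrix_k proj_theta_row (frame ic k q).

Lemma proj_theta_row_linear q : linear (@proj_theta_row q).
Proof.
move=> a u v; rewrite /proj_theta_row (mdiff_is_linear sP) !linearP.
by rewrite scale_row_mx add_row_mx.
Qed.

Lemma proj_theta_mxE q (v : TM P q) : cdom c q ->
  proj_theta_row v = chart_diff (chart_at q) c q v *m proj_theta_mx q.
Proof.
move=> cq; rewrite mulmx_sum_row.
have -> : v = \sum_k triv ic q v 0 k *: frame ic k q by exact: frame_sum.
pose L : {linear TM P q -> 'rV[R]_(n + r)} :=
  HB.pack (@proj_theta_row q) (GRing.isLinear.Build _ _ _ _ _ (@proj_theta_row_linear q)).
rewrite -[LHS]/(L _) linear_sum; apply: eq_bigr => k _.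
rewrite linearZ rowK -(@frame_sum _ _ _ _ (TM P) ic q v)//.
Qed.

(** It is square because [P] has dimension [n + r], and it is surjective. *)
Lemma proj_theta_mx_unit q : cdom c q -> cdom d (pr q) -> tdom j (pr q) ->
  proj_theta_mx q \in unitmx.
Proof.
move=> cq dq jq; rewrite -row_full_unit -sub1mx.
apply/row_subP => k; set y := row k _.
have id : tdom (exist _ d ad : tidx (TM M)) (pr q) by [].
have [v [vw vu]] := proj_theta_surjective
  (trivV (exist _ d ad : tidx (TM M)) (pr q) (lsubmx y)) (trivV j (pr q) (rsubmx y)).
apply/submxP; exists (chart_diff (chart_at q) c q v).
rewrite -proj_theta_mxE// /proj_theta_row vw vu trivVK//.
have := trivVK id (lsubmx y); rewrite /= => ->.
by rewrite hsubmxK.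
Qed.

Lemma proj_theta_mx_smooth q k l : cdom c q -> cdom d (pr q) -> tdom j (pr q) ->
  msmooth_at q (fun q => proj_theta_mx q k l : R^o).
Proof.
move=> cq dq jq.
have sX : ssmooth_at q (frame ic k) by exact: ssmooth_at_trivV.
have s1 := @ssmooth_at_mdiff _ _ _ _ _ _ sP q _ sX (exist _ d ad) dq.
have s2 := @ssmooth_at_bmap _ _ _ _ _ _ _ theta q _ sX j jq.
case: (splitP l) => [l'|l'] ll'.
  apply: msmooth_at_eq (msmooth_at_coord l' s1).
  apply: filterE => q'; rewrite [RHS]mxE /proj_theta_row.
  rewrite (_ : l = lshift r l'); last exact: val_inj.
  by rewrite row_mxEl.
apply: msmooth_at_eq (msmooth_at_coord l' s2).
apply: filterE => q'; rewrite [RHS]mxE /proj_theta_row.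
rewrite (_ : l = rshift n l'); last exact: val_inj.
by rewrite row_mxEr.
Qed.

End Splitting.

Lemma proj_theta_injective (p : P) (v v' : TM P p) :
  mdiff pr v = mdiff pr v' -> theta p v = theta p v' -> v = v'.
Proof.
move=> dv tv.
have cp := cdom_at p; have ac := atlas_at p.
have dp := cdom_at (pr p); have ad := atlas_at (pr p).
have jp := tdom_at F (pr p).
have U := proj_theta_mx_unit ac ad cp dp jp.
have : proj_theta_row (chart_at (pr p)) (triv_at F (pr p)) v =
       proj_theta_row (chart_at (pr p)) (triv_at F (pr p)) v'.
  by rewrite /proj_theta_row dv tv.
rewrite !(proj_theta_mxE _ _ ac)// => /(can_inj (mulmxK U)).
by rewrite !chart_diff_id.
Qed.

Variable a : bmap E F.

(** This vector is the horizontal lift of [xi e] plus [rho (a e)]; prescribing its two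
    images avoids constructing the horizontal lift. *)
Definition shear_lift (p : P) (e : E (pr p)) : TM P p :=
  projT1 (cid (proj_theta_surjective (xi (pr p) e) (a (pr p) e))).

Lemma mdiff_shear_lift p (e : E (pr p)) : mdiff pr (shear_lift e) = xi (pr p) e.
Proof. by rewrite /shear_lift; case: cid => v []. Qed.

Lemma theta_shear_lift p (e : E (pr p)) : theta p (shear_lift e) = a (pr p) e.
Proof. by rewrite /shear_lift; case: cid => v []. Qed.

Lemma shear_lift_linear p : linear (@shear_lift p).
Proof.
move=> k u v; apply: proj_theta_injective.
  by rewrite (mdiff_is_linear sP) !mdiff_shear_lift linearP.
by rewrite linearP !theta_shear_lift linearP.
Qed.

(** In coordinates the lift solves a linear system with smooth invertible matrix. *)
Lemma shear_lift_smooth p (e : section PE) : ssmooth_at p e ->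
  ssmooth_at p ((fun q => shear_lift (e q)) : section (TM P)).
Proof.
move=> se; set c := chart_at p; set d := chart_at (pr p); set j := triv_at F (pr p).
have [cp ac] : cdom c p /\ atlas c by split; [exact: cdom_at|exact: atlas_at].
have [dp ad] : cdom d (pr p) /\ atlas d by split; [exact: cdom_at|exact: atlas_at].
have jp : tdom j (pr p) by exact: tdom_at.
apply: (@ssmooth_at_triv _ _ _ _ (TM P) (exist _ c ac)) => //.
pose B q := proj_theta_mx d j ac q.
pose y (q : P) := row_mx (chart_diff (chart_at (pr q)) d (pr q) (xi (pr q) (e q)))
  (triv j (pr q) (a (pr q) (e q))).
have N1 : \forall q \near p, [/\ cdom c q, cdom d (pr q) & tdom j (pr q)].
  apply: filterS3 (near_cdom cp) (near_pullback sP (near_cdom dp))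
    (near_pullback sP (near_tdom jp)) => q //.
apply: (@msmooth_at_eq _ _ _ _ _ (fun q => y q *m invmx (B q))).
  apply: filterS N1 => q [cq dq jq].
  have UB : B q \in unitmx by exact: proj_theta_mx_unit.
  apply: (can_inj (mulmxK UB)); rewrite mulmxKV//.
  by rewrite -(proj_theta_mxE _ _ ac)// /proj_theta_row mdiff_shear_lift theta_shear_lift.
have s1 := @ssmooth_at_pull_bmap _ _ _ _ _ _ sP _ _ _ _ xi p _ se (exist _ d ad) dp.
have s2 := @ssmooth_at_pull_bmap _ _ _ _ _ _ sP _ _ _ _ a p _ se j jp.
have sy : msmooth_at p y.
  apply: msmooth_at_row => l; case: (splitP l) => l' ll'.
    apply: msmooth_at_eq (msmooth_at_coord l' s1).
    apply: filterE => q; rewrite /y (_ : l = lshift r l'); last exact: val_inj.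
    by rewrite row_mxEl.
  apply: msmooth_at_eq (msmooth_at_coord l' s2).
  apply: filterE => q; rewrite /y (_ : l = rshift n l'); last exact: val_inj.
  by rewrite row_mxEr.
apply: (smooth_at_mulmx sy) => k l; apply: smooth_at_invmx.
  by rewrite (cmapK cp); exact: proj_theta_mx_unit.
by move=> k' l'; exact: proj_theta_mx_smooth.
Qed.

Lemma exists_shear_lift : exists xi' : bmap PE (TM P),
  forall p (e : E (pr p)), mdiff pr (xi' p e) = xi (pr p) e /\
    theta p (xi' p e) = a (pr p) e.
Proof.
pose lf (p : P) : {linear PE p -> TM P p} :=
  HB.pack (@shear_lift p) (GRing.isLinear.Build _ _ _ _ (@shear_lift p) (@shear_lift_linear p)).
have sm (i : tidx PE) (u : 'rV[R]_r) :
    smooth_section_on (tdom i) (fun p => lf p (trivV i p u) : TM P p).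
  apply/(smooth_section_onP _ (tdom_open i)) => p ip.
  by apply: shear_lift_smooth; exact: ssmooth_at_trivV.
exists (BMap sm) => p e; split; [exact: mdiff_shear_lift|exact: theta_shear_lift].
Qed.

End ShearLift.

Section LiftProperties.
Variables (R : realType) (n r : nat) (M : manifold R n).
Variables (E F : vbundle M r) (DE : covder E) (DF : covder F).
Arguments DE : clear implicits.
Arguments DF : clear implicits.
Hypotheses (hDE : is_connection DE) (hDF : is_connection DF).
Variables (xi : bmap E (TM M)) (omega : twoform F) (a : bmap E F).
Hypothesis a_primitive : forall (X : section (TM M)) (e : section E),
  smooth_section X -> smooth_section e -> forall x,
  contract2 xi omega (X x) (e x) = - hom_covder DE DF (fun y => a y) (X x) e.

Section PulledBackPrimitive.
Variables (m : nat) (N : manifold R m) (f : N -> M) (sf : smooth_map f).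

(** Expand [e] in a pulled-back frame: the terms that differentiate the coefficients
    cancel, and on the frame the formula is the pull-back of [d a = - xi _| omega]. *)
Lemma pullback_exact p (v : TM N p) (e : section (pullback E sf)) :
  ssmooth_at p e ->
  pullback_covder sf DF p v (fun q => a (f q) (e q)) -
    a (f p) (pullback_covder sf DE p v e) =
  - omega (f p) (xi (f p) (e p)) (mdiff f v).
Proof.
move=> se; set i := triv_at E (f p); have ip : tdom i (f p) by exact: tdom_at.
have ip' : @tdom _ _ _ _ (pullback E sf) i p by [].
pose g k (q : N) : R^o := triv i (f q) (e q) 0 k.
have sg k : msmooth_at p (g k).
  exact: (@msmooth_at_component _ _ _ _ (pullback E sf) i p e k ip se).
have sk k : ssmooth_at (f p) (frame i k) by exact: ssmooth_at_frame.
have sak k : ssmooth_at (f p) ((fun y => a y (frame i k y)) : section F).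
  exact: (ssmooth_at_bmap a).
pose s k : section (pullback F sf) := fun q => a (f q) (frame i k (f q)).
have ss k : ssmooth_at p (s k).
  exact: (@ssmooth_at_pull _ _ _ _ _ _ F f sf p _ (sak k)).
have -> : pullback_covder sf DF p v (fun q => a (f q) (e q)) =
    pullback_covder sf DF p v (fun q => \sum_k (g k q : R) *: s k q).
  apply: pullback_covder_local; apply: filterS (near_tdom ip') => q iq.
  rewrite {1}(frame_sum (e q : E (f q)) iq) linear_sum.
  by apply: eq_bigr => k _; rewrite linearZ.
rewrite pullback_covder_sum// (pullback_covderE (sf := sf)) -/i linear_sum -sumrB.
rewrite {2}(frame_sum (e p : E (f p)) ip) linear_sum.
have suml : omega (f p) (\sum_k triv i (f p) (e p) 0 k *: xi (f p) (frame i k (f p)))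
    (mdiff f v) =
    \sum_k triv i (f p) (e p) 0 k *: omega (f p) (xi (f p) (frame i k (f p))) (mdiff f v).
  pose L : {linear TM M (f p) -> F (f p)} := HB.pack ((omega (f p))^~ (mdiff f v))
    (GRing.isLinear.Build _ _ _ _ _ (twoform_linearl omega (mdiff f v))).
  by rewrite -[LHS]/(L _) linear_sum; apply: eq_bigr => k _; rewrite linearZ.
under [X in omega _ X]eq_bigr => k _ do rewrite linearZ.
rewrite suml -sumrN; apply: eq_bigr => k _.
rewrite (exact_germ hDE hDF a_primitive _ (sk k)).
rewrite (pullback_covder_pull sf hDF v (sak k)) linearP linearZ /=.
rewrite opprD addrACA subrr add0r -[RHS]scalerN opprB scalerBr.
by [].
Qed.

End PulledBackPrimitive.

Hypothesis xi_isotropic : forall x (e1 e2 : E x), omega x (xi x e1) (xi x e2) = 0.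
Hypothesis hxi : torsion_free DE xi.
Variable (P : shear_total_space DF omega).

Local Notation pr := (sts_proj P).
Local Notation sP := (sts_smooth P).
Local Notation PE := (pullback E sP).
Local Notation PF := (pullback F sP).
Local Notation DPE := (pullback_covder sP DE).
Local Notation DPF := (pullback_covder sP DF).
Local Notation theta := (sts_theta P).

Variable xi' : bmap PE (TM P).
Hypothesis cov : forall p (e : E (pr p)), mdiff pr (xi' p e) = xi (pr p) e.
Hypothesis th : forall p (e : E (pr p)), theta p (xi' p e) = a (pr p) e.

Lemma shear_lift_preserves_theta (X : section (TM P)) (e : section PE) :
  smooth_section X -> smooth_section e -> forall p,
  lie_derivative1 DPE DPF xi' theta X e p = 0.
Proof.
move=> sX se p; rewrite /lie_derivative1 /hom_covder /contract1.
rewrite (sts_d_theta (s := P)) ?cov ?th; last first.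
- exact: sX.
- exact: (smooth_section_bmap xi').
have -> : (fun q => theta q (xi' q (e q))) = (fun q => a (pr q) (e q)).
  by apply: functional_extensionality_dep => q; exact: th.
move/smooth_sectionP: se => /(_ p) se.
by rewrite (pullback_exact (X p) se) addNr.
Qed.

(** By the formula for [d theta] the two sides differ by values of [omega] on pairs of
    vectors in the image of [xi], which vanish. *)
Lemma theta_shear_lift_torsion (e1 e2 : section PE) p :
  smooth_section e1 -> smooth_section e2 ->
  theta p (xi' p (DPE p (xi' p (e1 p)) e2 - DPE p (xi' p (e2 p)) e1)) =
  theta p (lie_bracket (fun q => xi' q (e1 q)) (fun q => xi' q (e2 q)) p).
Proof.
move=> s1 s2.
have := sts_d_theta (smooth_section_bmap xi' s1) (smooth_section_bmap xi' s2) p.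
rewrite /ext_d1 !cov xi_isotropic => /subr0_eq <-; rewrite th.
have thE (e : section PE) : (fun q => theta q (xi' q (e q))) = (fun q => a (pr q) (e q)).
  by apply: functional_extensionality_dep => q; exact: th.
rewrite !thE; move/smooth_sectionP: s1 => /(_ p) s1; move/smooth_sectionP: s2 => /(_ p) s2.
have := pullback_exact (xi' p (e1 p)) s2; rewrite cov xi_isotropic oppr0 => /subr0_eq ->.
have := pullback_exact (xi' p (e2 p)) s1; rewrite cov xi_isotropic oppr0 => /subr0_eq ->.
exact: linearB.
Qed.

(** In a frame pulled back from [M], [mdiff_bracket] reduces the bracket of the lifts to
    brackets of the [xi] of frame sections, computed by the torsion-freeness of [xi], and
    to derivatives of coefficients that also occur in the pulled-back connection. *)
Lemma proj_shear_lift_torsion (e1 e2 : section PE) p :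
  smooth_section e1 -> smooth_section e2 ->
  mdiff pr (xi' p (DPE p (xi' p (e1 p)) e2 - DPE p (xi' p (e2 p)) e1)) =
  mdiff pr (lie_bracket (fun q => xi' q (e1 q)) (fun q => xi' q (e2 q)) p).
Proof.
move=> /smooth_sectionP/(_ p) s1 /smooth_sectionP/(_ p) s2.
set i := triv_at E (pr p); have ip : tdom i (pr p) by exact: tdom_at.
have ip' : @tdom _ _ _ _ PE i p by [].
have sk k : ssmooth_at (pr p) (frame i k) by exact: ssmooth_at_frame.
have /choice[t tE] k : exists t : section E, smooth_section t /\
    \forall y \near pr p, t y = frame i k y.
  by have [t st te] := extend_section (sk k); exists t.
have st k : smooth_section (t k) by case: (tE k).
have te k : \forall y \near pr p, t k y = frame i k y by case: (tE k).
have stp k : ssmooth_at (pr p) (t k) by have /smooth_sectionP := st k; exact.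
have tp k : t k (pr p) = frame i k (pr p) := nbhs_singleton (te k).
pose Z k : section (TM M) := fun y => xi y (t k y).
have sZ k : ssmooth_at (pr p) (Z k) by exact: (ssmooth_at_bmap xi).
pose g (e : section PE) k (q : P) : R^o := triv i (pr q) (e q) 0 k.
have sg e k : ssmooth_at p e -> msmooth_at p (g e k).
  by move=> se; exact: (@msmooth_at_component _ _ _ _ PE i p e k ip se).
have gE e : \forall q \near p, mdiff pr (xi' q (e q)) = \sum_k (g e k q : R) *: Z k (pr q).
  have N1 : \forall q \near p, forall k, t k (pr q) = frame i k (pr q).
    exact: filter_forall (fun k => near_pullback sP (te k)).
  apply: filterS2 N1 (near_tdom ip') => q tq iq.
  rewrite cov {1}(frame_sum (e q : E (pr q)) iq) linear_sum.
  by apply: eq_bigr => k _; rewrite linearZ /Z tq.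
have sX e : ssmooth_at p e -> ssmooth_at p ((fun q => xi' q (e q)) : section (TM P)).
  by move=> se; exact: (ssmooth_at_bmap xi').
rewrite (mdiff_bracket sP (sX _ s1) (sX _ s2) (fun k => sg e1 k s1) (fun k => sg e2 k s2)
  sZ (gE e1) (gE e2)).
have brE k l : lie_bracket (Z l) (Z k) (pr p) =
    xi (pr p) (DE (pr p) (Z l (pr p)) (t k)) - xi (pr p) (DE (pr p) (Z k (pr p)) (t l)).
  by rewrite -(hxi (st l) (st k)) linearB.
have DE_E (e e' : section PE) : DPE p (xi' p (e p)) e' =
    \sum_k (dirder (xi' p (e p)) (g e' k) *: t k (pr p) +
      (g e' k p : R) *: \sum_l (g e l p : R) *: DE (pr p) (Z l (pr p)) (t k)).
  rewrite (pullback_covderE (sf := sP)) -/i; apply: eq_bigr => k _; rewrite tp.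
  congr (_ + _ *: _); rewrite -(conn_local hDE _ (stp k) (te k)).
  by rewrite (nbhs_singleton (gE e)) (conn_vec_sum hDE).
pose T l k := xi (pr p) (DE (pr p) (Z l (pr p)) (t k)).
have xiDE (e e' : section PE) : xi (pr p) (DPE p (xi' p (e p)) e') =
    \sum_k dirder (xi' p (e p)) (g e' k) *: Z k (pr p) +
    \sum_k \sum_l ((g e' k p : R) * g e l p) *: T l k.
  rewrite DE_E linear_sum -big_split; apply: eq_bigr => k _ /=.
  rewrite linearD !linearZ (linear_sum (xi (pr p))) /=; congr (_ + _).
  by rewrite scaler_sumr; apply: eq_bigr => l _; rewrite linearZ scalerA.
rewrite cov; apply: etrans (linearB (xi (pr p)) _ _) _.
apply: etrans (congr2 (fun u w => u - w) (xiDE e1 e2) (xiDE e2 e1)) _.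
rewrite opprD addrACA -sumrB; congr (_ + _).
  by apply: eq_bigr => k _; rewrite scalerBl.
under [RHS]eq_bigr => k _ do under eq_bigr => l _ do rewrite brE scalerBr.
under [RHS]eq_bigr => k _ do rewrite sumrB.
rewrite sumrB; congr (_ - _).
rewrite exchange_big; apply: eq_bigr => k _ /=; apply: eq_bigr => l _.
by rewrite mulrC.
Qed.

Lemma shear_lift_torsion_free : torsion_free DPE xi'.
Proof.
move=> e1 e2 s1 s2 p; apply: (proj_theta_injective (P := P)).
  exact: proj_shear_lift_torsion.
exact: theta_shear_lift_torsion.
Qed.

End LiftProperties.

Theorem theorem3p5 (R : realType) (n r : nat) (M : manifold R n)
  (E F : vbundle M r) (DE : covder E) (DF : covder F)
  (hDE : is_connection DE) (hDF : is_connection DF)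
  (flatE : is_flat DE) (flatF : is_flat DF)
  (xi : bmap E (TM M)) (hxi : torsion_free DE xi)
  (omega : twoform F)
  (d_omega : forall X Y Z : section (TM M),
    smooth_section X -> smooth_section Y -> smooth_section Z ->
    forall x, ext_d2 DF omega X Y Z x = 0)
  (P : shear_total_space DF omega) :
  (exists xi' : bmap (pullback E (sts_smooth P)) (TM P),
    [/\ (forall (p : P) (e : E (sts_proj P p)),
           mdiff (sts_proj P) (xi' p e) = xi (sts_proj P p) e),
        (forall (X : section (TM P)) (e : section (pullback E (sts_smooth P))),
           smooth_section X -> smooth_section e -> forall p,
           lie_derivative1 (pullback_covder (sts_smooth P) DE)
             (pullback_covder (sts_smooth P) DF) xi' (sts_theta P) X e p = 0)
      & torsion_free (pullback_covder (sts_smooth P) DE) xi'])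
  <->
  [/\ (forall (X Y : section (TM M)) (e : section E),
         smooth_section X -> smooth_section Y -> smooth_section e -> forall x,
         lie_derivative2 DE DF xi omega X Y e x = 0),
      (exists a : bmap E F, forall (X : section (TM M)) (e : section E),
         smooth_section X -> smooth_section e -> forall x,
         contract2 xi omega (X x) (e x) = - hom_covder DE DF (fun y => a y) (X x) e)
    & (forall x (e1 e2 : E x), omega x (xi x e1) (xi x e2) = 0)].
Proof.
split=> [[xi' [cov theta_preserved tf]]|[_ [a a_primitive] xi_isotropic]].
  have [a desc] := pairing_descends hDE hDF cov theta_preserved.
  have a_primitive := pairing_exact hDE hDF cov theta_preserved desc.
  split; [|by exists a|exact: torsion_free_isotropic cov theta_preserved tf].
  move=> X Y e sX sY se x; rewrite /lie_derivative2.
  rewrite (flat_exact_closed hDE hDF a_primitive flatE flatF)// add0r.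
  by apply: d_omega => //; exact: (smooth_section_bmap xi).
have [xi' xi'E] := exists_shear_lift xi P a.
have cov p (e : E (sts_proj P p)) := (xi'E p e).1.
have th p (e : E (sts_proj P p)) := (xi'E p e).2.
exists xi'; split=> //.
  exact: (shear_lift_preserves_theta hDE hDF a_primitive cov th).
exact: (shear_lift_torsion_free hDE hDF a_primitive xi_isotropic hxi cov th).
Qed.
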